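(* Let $G$ be an essential reflection group acting on $V\cong\mathbb{R}^n$ with basic invariants $\pi_1,\dots,\pi_n$ ordered by nondecreasing degree. Let $f \in \mathbb{R}[V]^G$ be a $G$-finite polynomial and $X = \mathrm{V}_{\mathbb{R}}(f)$. If $f \in \mathbb{R}[\pi_1,\dots,\pi_k]$, then $$X \neq \emptyset \quad\text{if and only if}\quad X \cap \mathcal{H}_{\sigma_G(k)} \neq \emptyset.$$ If $d=\deg(f)$, then $$X \neq \emptyset \quad\text{if and only if}\quad X \cap \mathcal{H}_{\delta_G(d)} \neq \emptyset.$$
   Context: A (real) reflection group $G$ acting on a Euclidean space $V \cong \mathbb{R}^n$ is a finite group of orthogonal transformations generated by reflections; it is essential if it does not fix a nontrivial linear subspace. The reflection arrangement is the set of reflection hyperplanes of all reflections in $G$; flats are the linear subspaces arising as intersections of these hyperplanes (including $V$ itself), and $\mathcal{H}_i=\mathcal{H}_i(G)$ is the set of points of $V$ contained in a flat of dimension $i$ (so $\mathcal{H}_n=V$). $\mathbb{R}[V]^G$ is the ring of $G$-invariant polynomials on $V$. A set of basic invariants $\pi_1,\dots,\pi_n$ is a set of algebraically independent homogeneous generators of $\mathbb{R}[V]^G$, labelled by nondecreasing degree; the degrees $d_i(G)=\deg\pi_i$ depend only on $G$. For a reflection subgroup $G'\subseteq G$ (a subgroup that is itself a reflection group on $V$), $d_n(G')$ is the largest degree of its basic invariants. A point $p$ is $G'$-general if it does not lie on any reflection hyperplane of $G'$. For a positive integer $d$, $\delta_G(d)$ is the largest number $\ell$ such that for every $p \in \mathcal{H}_{\ell+1}$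 there is a reflection subgroup $G' \subseteq G$ such that $p$ is $G'$-general and $2d_n(G') > d$. Moreover, $\sigma_G(k) := \delta_G(2d_k(G))$; that is, $\sigma_G(k)$ is the largest $\ell$ such that for every $p\in\mathcal{H}_{\ell+1}$ there is a reflection subgroup $G'\subseteq G$ such that $p$ is $G'$-general and $d_n(G')>d_k(G)$. $\mathrm{V}_{\mathbb{R}}(f)=\{p\in V: f(p)=0\}$. An invariant polynomial $f\in\mathbb{R}[V]^G$ is $G$-finite if either $\mathrm{V}_{\mathbb{R}}(f)=\emptyset$ or there is a point $p\in \mathrm{V}_{\mathbb{R}}(f)$ such that $f$ has finitely many extreme points (points of local maximum or minimum) when restricted to the sphere $K=\{q\in V:\|q\|=\|p\|\}$.
   Formalization: δ_G(d) is taken as the smallest ℓ such that every p in H_{ℓ+1} outside H_ℓ is G'-general for some G' with 2d_n(G')>d, since the stated maximum is ill-defined; the second equivalence uses δ_G(max(4,d)), since it fails for d=2,3 (e.g. x²−2y²+1 for A_1×A_1). *)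

(* Defs.v *)
From HB Require Import structures.
From mathcomp Require Import all_boot all_order all_algebra.
From mathcomp Require Import boolp classical_sets cardinality reals.
From mathcomp Require Import mpoly.

Set Implicit Arguments.
Unset Strict Implicit.
Unset Printing Implicit Defensive.

Import Order.TTheory GRing.Theory Num.Theory.

Local Open Scope classical_set_scope.
Local Open Scope ring_scope.

(* MathComp / MathComp-Analysis.  V is 'rV[R]_n with the standard inner        *)
(* product, R : realType; linear maps are matrices acting on the right of row  *)
(* vectors.                                                                    *)

Section ReflectionGroups.
Variables (R : realType) (n : nat).
Implicit Types (G : set 'M[R]_n) (s g : 'M[R]_n) (v p q : 'rV[R]_n).
Implicit Types (f : {mpoly R[n]}) (pi : n.-tuple {mpoly R[n]}).

(* Euclidean norm (the library norm on 'rV is the sup norm). *)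
Definition enorm v : R := Num.sqrt (\sum_(i < n) v 0 i ^+ 2).

(* v |-> v - 2 <v, a> / <a, a> a *)
Definition is_reflection s : Prop :=
  exists2 a : 'rV[R]_n, a != 0 &
    s = 1%:M - (2 / (a *m a^T) 0 0) *: (a^T *m a).

Definition reflections G : set 'M[R]_n := [set s | G s /\ is_reflection s].

Definition orthogonal_group G : Prop :=
  [/\ G 1%:M,
      forall g h, G g -> G h -> G (g *m h),
      forall g, G g -> G (invmx g)
    & forall g, G g -> g *m g^T = 1%:M].

Definition reflection_group G : Prop :=
  [/\ finite_set G,
      orthogonal_group G
    & forall g, G g -> exists2 S : seq 'M[R]_n,
        (forall s, s \in S -> reflections G s) &
        g = \big[mulmx/1%:M]_(s <- S) s].

Definition reflection_subgroup G' G : Prop :=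
  reflection_group G' /\ G' `<=` G.

Definition essential G : Prop :=
  forall v, (forall g, G g -> v *m g = v) -> v = 0.

(* Subspaces are row spaces: the hyperplane of the reflection s is its fixed   *)
(* space, and the empty intersection is V.                                     *)
Definition hyperplane s : 'M[R]_n := kermx (s - 1%:M).

Definition flat (S : seq 'M[R]_n) : 'M[R]_n :=
  (\bigcap_(s <- S) hyperplane s)%MS.

(* H_i: the points lying on a flat of dimension i. *)
Definition flat_points G (i : nat) : set 'rV[R]_n :=
  [set p | exists S : seq 'M[R]_n,
     [/\ forall s, s \in S -> reflections G s,
         \rank (flat S) = i
       & (p <= flat S)%MS]].

Definition general G p : Prop :=
  forall s, reflections G s -> ~~ (p <= hyperplane s)%MS.

Definition peval f v : R := f.@[fun i => v 0 i].

(* Total degree, with deg 0 = 0. *)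
Definition deg f : nat := (msize f).-1.

Definition invariant_poly G f : Prop :=
  forall g v, G g -> peval f (v *m g) = peval f v.

Definition basic_invariants G pi : Prop :=
  [/\ forall i, invariant_poly G (tnth pi i),
      forall i, exists d, tnth pi i \is d.-homog,
      forall h : {mpoly R[n]}, h \mPo pi = 0 -> h = 0,
      forall f, invariant_poly G f -> exists h : {mpoly R[n]}, f = h \mPo pi
    & forall i j : 'I_n, (i <= j)%N -> (deg (tnth pi i) <= deg (tnth pi j))%N].

(* m = d_n(G): the largest degree of a set of basic invariants of G, which     *)
(* exists and whose degrees depend only on G (Chevalley).                      *)
Definition top_degree G (m : nat) : Prop :=
  exists2 pi, basic_invariants G pi & m = \max_(i < n) deg (tnth pi i).

(* The algebra R[pi_1, ..., pi_(k+1)]: indices start at 0, so (k : 'I_n) is    *)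
(* the position of the last invariant that may occur.                          *)
Definition in_first_invariants pi (k : 'I_n) f : Prop :=
  exists h : {mpoly R[k.+1]},
    f = h \mPo [tuple tnth pi (widen_ord (ltn_ord k) i) | i < k.+1].

Definition has_general_subgroup G (d : nat) p : Prop :=
  exists G' m, [/\ reflection_subgroup G' G, general G' p,
                   top_degree G' m & (d < 2 * m)%N].

Definition delta_bound G (d l : nat) : Prop :=
  forall p, flat_points G l.+1 p -> ~ flat_points G l p ->
    has_general_subgroup G d p.

Lemma delta_bound_ex G (d : nat) : exists l, `[< delta_bound G d l >].
Proof.
exists n; apply/asboolP => p [S [_ rS _]].
by have := rank_leq_row (flat S); rewrite rS ltnn.
Qed.

(* The smallest l such that every point of H_(l+1) outside H_l is G'-general   *)
(* for a reflection subgroup G' of G with 2 d_n(G') > d.  A maximum over l,    *)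
(* or a condition on all of H_(l+1), would be void: H_(l+1) contains 0, which  *)
(* is G'-general for the trivial G' only.                                      *)
(* Pitfall: delta G 2 = delta G 3 = 0 if G is essential, and an invariant of   *)
(* degree d = 2, 3 with a real zero need not have one in H_(delta G d), e.g.   *)
(* x^2 - 2 y^2 + 1 for A_1 x A_1;                                              *)
(* as in Timofte's bound max(2, d./2), use delta G (maxn 4 d).                 *)
Definition delta G (d : nat) : nat := ex_minn (delta_bound_ex G d).

(* d_(k+1)(G) is read off the given basic invariants pi of G. *)
Definition sigma G pi (k : 'I_n) : nat := delta G (2 * deg (tnth pi k)).

Definition real_variety f : set 'rV[R]_n := [set p | peval f p = 0].

Definition sphere_through p : set 'rV[R]_n := [set q | enorm q = enorm p].

Definition local_max_on (K : set 'rV[R]_n) f q : Prop :=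
  exists2 e : R, 0 < e &
    forall x, K x -> enorm (x - q) < e -> peval f x <= peval f q.

Definition local_min_on (K : set 'rV[R]_n) f q : Prop :=
  exists2 e : R, 0 < e &
    forall x, K x -> enorm (x - q) < e -> peval f q <= peval f x.

Definition extreme_points (K : set 'rV[R]_n) f : set 'rV[R]_n :=
  [set q | K q /\ (local_max_on K f q \/ local_min_on K f q)].

Definition G_finite f : Prop :=
  real_variety f = set0 \/
  exists2 p, real_variety f p &
    finite_set (extreme_points (sphere_through p) f).

End ReflectionGroups.

(* Main.v *)
(* On the sphere through a zero of [f], let [q1] and [q2] be points where [f]    *)
(* is minimal and maximal. Rays from the origin stay inside flats, so a zero on  *)
(* the ray to [q1] or to [q2], given by the intermediate value theorem, lies in  *)
(* any [flat_points G l] containing these two extreme points.                    *)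
(*                                                                               *)
(* Suppose an extreme point [q] is general for a reflection subgroup [H] whose   *)
(* top basic invariant [pi_n] has large degree. A general point has trivial      *)
(* stabilizer (exchange condition), so averaging over [H] produces invariants    *)
(* with any prescribed gradient at [q]; hence the gradients of the basic         *)
(* invariants of [H] are independent at [q] and the orbit map is open there. So  *)
(* one can move [pi_n] near [q] while fixing the other invariants. By degrees,   *)
(* the squared norm does not involve [pi_n] and [f] is affine in it; extremality *)
(* forces [f] to be constant along this motion, which gives infinitely many      *)
(* extreme points. So [q] has no such subgroup, and then, comparing [q] with     *)
(* generic points of smaller flats, [q] lies in [flat_points G (delta G d)].     *)

(* Openness of the orbit map rests on [general_stabilizer], proved by the usual chamber argument:
   every reflection is a product of reflections in walls of the chamber of the base point, and
   [exchange] shortens any nonempty product fixing that point. [invariant_with_gradient] then yields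
   [gradients_independent], and a Newton argument, [local_surjection], realizes all small prescribed
   changes of the basic invariants ([orbit_map_open]).

   [affine_in_top_invariant] is a weight count: in an invariant of degree below twice that of a
   basic invariant, the latter has exponent at most one. Hence [not_extreme_of_affine] and
   [extreme_not_general], which exclude subgroups with [d < 2 * m] at an extreme point. The squared
   norm must not involve the top invariant, so its degree has to exceed 2. This is what [4 <= d]
   ensures: for [delta] it comes from [maxn 4 (deg f)], for [sigma] from [degree_ge2].

   [flat_points_of_not_general] turns the exclusion into membership in a flat of dimension
   [delta G d]. [zero_on_flat] serves both equivalences, which differ only in why [f] is affine in
   the top invariant. *)
Require Import Defs.
From mathcomp Require Import all_boot all_order all_algebra.
From mathcomp Require Import boolp classical_sets cardinality reals.
From mathcomp Require Import topology normedtype derive.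
From mathcomp Require Import ring lra zify.
From mathcomp Require Import -(notations) mpoly.

Set Implicit Arguments.
Unset Strict Implicit.
Unset Printing Implicit Defensive.

Import Order.TTheory GRing.Theory Num.Theory.
Import numFieldNormedType.Exports.

Local Open Scope classical_set_scope.
Local Open Scope ring_scope.

(** * Stabilizers of general points *)

Section InnerProduct.
Variables (R : realType) (n : nat).
Implicit Types (u v w : 'rV[R]_n) (g h s t : 'M[R]_n) (G : set 'M[R]_n).

Definition dot u v : R := (u *m v^T) 0 0.

Lemma dotE u v : dot u v = \sum_i u 0 i * v 0 i.
Proof. by rewrite /dot mxE; apply: eq_bigr => i _; rewrite mxE. Qed.

Lemma dotC u v : dot u v = dot v u.
Proof. by rewrite !dotE; apply: eq_bigr => i _; rewrite mulrC. Qed.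

Lemma dotDl u v w : dot (u + v) w = dot u w + dot v w.
Proof. by rewrite /dot mulmxDl mxE. Qed.

Lemma dotZl (a : R) u v : dot (a *: u) v = a * dot u v.
Proof. by rewrite /dot -scalemxAl mxE. Qed.

Lemma dotNl u v : dot (- u) v = - dot u v.
Proof. by rewrite -scaleN1r dotZl mulN1r. Qed.

Lemma dotBl u v w : dot (u - v) w = dot u w - dot v w.
Proof. by rewrite dotDl dotNl. Qed.

Lemma dotDr u v w : dot u (v + w) = dot u v + dot u w.
Proof. by rewrite dotC dotDl !(dotC u). Qed.

Lemma dotZr (a : R) u v : dot u (a *: v) = a * dot u v.
Proof. by rewrite dotC dotZl dotC. Qed.

Lemma dotNr u v : dot u (- v) = - dot u v.
Proof. by rewrite dotC dotNl dotC. Qed.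

Lemma dotBr u v w : dot u (v - w) = dot u v - dot u w.
Proof. by rewrite dotDr dotNr. Qed.

Lemma dot0l u : dot 0 u = 0.
Proof. by rewrite /dot mul0mx mxE. Qed.

Lemma dotvv_ge0 u : 0 <= dot u u.
Proof. by rewrite dotE; apply: sumr_ge0 => i _; rewrite -expr2 sqr_ge0. Qed.

Lemma dotvv_eq0 u : (dot u u == 0) = (u == 0).
Proof.
apply/idP/eqP => [|->]; last by rewrite dot0l.
rewrite dotE psumr_eq0 => [|i _]; last by rewrite -expr2 sqr_ge0.
move=> /allP h; apply/rowP => i; rewrite mxE.
by have := h i (mem_index_enum i); rewrite /= -expr2 sqrf_eq0 => /eqP.
Qed.

Lemma dotvv_gt0 u : (0 < dot u u) = (u != 0).
Proof. by rewrite lt_neqAle dotvv_ge0 andbT eq_sym dotvv_eq0. Qed.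

Lemma dot_mulmx u v g : dot (u *m g) v = dot u (v *m g^T).
Proof. by rewrite /dot trmx_mul trmxK mulmxA. Qed.

Lemma enormE u : enorm u = Num.sqrt (dot u u).
Proof. by rewrite /enorm dotE; congr Num.sqrt; apply: eq_bigr => i _; rewrite expr2. Qed.

Lemma trmx_reflection s : is_reflection s -> s^T = s.
Proof.
by case=> a _ ->; rewrite raddfB /= trmx1 linearZ /= trmx_mul trmxK.
Qed.

(** Scaling the root to squared length 2 removes the denominator; its sign is chosen to put [c] on
    the positive side. *)
Lemma reflection_root s c : is_reflection s -> c *m s != c ->
  exists a, [/\ dot a a = 2, 0 < dot c a & s = 1%:M - a^T *m a].
Proof.
case=> a a0 -> h.
have aa0 : 0 < dot a a by rewrite dotvv_gt0.
have ca0 : dot c a != 0.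
  apply: contraNneq h => ca0; rewrite mulmxBr mulmx1 -scalemxAr mulmxA.
  by rewrite (mx11_scalar (c *m a^T)) -/(dot c a) ca0 -scalemx1 scale0r mul0mx scaler0 subr0.
pose k := Num.sqrt (2 / dot a a) * Num.sg (dot c a).
have sg2 : Num.sg (dot c a) ^+ 2 = 1 by rewrite sqr_sg ca0.
have k2 : k ^+ 2 = 2 / dot a a.
  by rewrite exprMn sg2 mulr1 sqr_sqrtr // divr_ge0 // ltW.
exists (k *: a); split.
- by rewrite dotZl dotZr mulrA -expr2 k2 divfK // gt_eqF.
- rewrite dotZr -mulrA mulr_gt0 //; first by rewrite sqrtr_gt0 divr_gt0.
  by rewrite -normrEsg normr_gt0.
- by rewrite -/(dot a a) [(k *: a)^T]linearZ /= -scalemxAr -scalemxAl scalerA -expr2 k2.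
Qed.

(** For a reflection [s], this says that its hyperplane strictly separates [u] from [v] (see
    [sep_root]): reflecting [u] then brings it closer to [v]. *)
Definition sep s u v := dot u v < dot (u *m s) v.

Lemma mul_reflection u a : u *m (1%:M - a^T *m a) = u - dot u a *: a.
Proof.
by rewrite mulmxBr mulmx1 mulmxA (mx11_scalar (u *m a^T)) mul_scalar_mx.
Qed.

Lemma sep_root a u v : sep (1%:M - a^T *m a) u v = (dot u a * dot v a < 0).
Proof.
by rewrite /sep mul_reflection dotBl dotZl (dotC a) -subr_lt0 opprB addrC subrK.
Qed.

End InnerProduct.

Lemma prod_mulmx_cat (R : realType) n (S T : seq 'M[R]_n) :
  \big[mulmx/1%:M]_(s <- S ++ T) s =
  \big[mulmx/1%:M]_(s <- S) s *m \big[mulmx/1%:M]_(s <- T) s.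
Proof.
elim: S => [|s S IH]; first by rewrite big_nil mul1mx.
by rewrite cat_cons !big_cons IH mulmxA.
Qed.

Section Chambers.
Variables (R : realType) (n : nat) (G : set 'M[R]_n).
Hypothesis HG : reflection_group G.
Implicit Types (u v c : 'rV[R]_n) (g h s t w : 'M[R]_n).

Lemma group_mulmxT g : G g -> g *m g^T = 1%:M.
Proof. by case: HG => _ [_ _ _ h] _; apply: h. Qed.

Lemma group_mulTmx g : G g -> g^T *m g = 1%:M.
Proof. by move=> /group_mulmxT /mulmx1C. Qed.

Lemma mem_group1 : G 1%:M. Proof. by case: HG => _ []. Qed.

Lemma mem_groupM g h : G g -> G h -> G (g *m h).
Proof. by case: HG => _ [_ hM _ _] _; apply: hM. Qed.

Lemma mem_groupT g : G g -> G g^T.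
Proof.
move=> Gg; have gu := group_mulmxT Gg.
have -> : g^T = invmx g; last by case: HG => _ [_ _ hV _] _; apply: hV.
have [gU _] := mulmx1_unit gu.
by rewrite -[LHS]mul1mx -(mulVmx gU) -mulmxA gu mulmx1.
Qed.

Lemma dot_group u v g : G g -> dot (u *m g) (v *m g) = dot u v.
Proof. by move=> Gg; rewrite dot_mulmx -mulmxA group_mulmxT // mulmx1. Qed.

Lemma reflections_conj g s : G g -> reflections G s -> reflections G (g *m s *m g^T).
Proof.
move=> Gg [Gs [a a0 sE]]; split; first exact/mem_groupM/mem_groupT/Gg/mem_groupM.
have ag : dot (a *m g^T) (a *m g^T) = dot a a by rewrite dot_group //; exact: mem_groupT.
exists (a *m g^T); first by rewrite -dotvv_eq0 ag dotvv_eq0.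
rewrite -/(dot _ _) ag sE -/(dot a a) mulmxBr mulmxBl mulmx1 group_mulmxT //.
by rewrite -scalemxAr -scalemxAl trmx_mul trmxK !mulmxA.
Qed.

Lemma reflection_involutive s : reflections G s -> s *m s = 1%:M.
Proof.
by move=> [Gs /trmx_reflection st]; rewrite -{2}st group_mulmxT.
Qed.

Section BasePoint.
Variable c : 'rV[R]_n.
Hypothesis Hc : general G c.

Lemma generalP s : reflections G s -> c *m s != c.
Proof.
move=> /Hc; apply: contra => /eqP h.
by apply/sub_kermxP; rewrite mulmxBr h mulmx1 subrr.
Qed.

Lemma root_at s : reflections G s ->
  exists a, [/\ dot a a = 2, 0 < dot c a & s = 1%:M - a^T *m a].
Proof. by move=> Rs; apply: reflection_root (generalP Rs); case: Rs. Qed.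

(** The hyperplane of [s] is a wall of the chamber of [c]: no other one lies between [c] and its
    mirror image. *)
Definition simple s :=
  reflections G s /\ forall t, reflections G t -> sep t c (c *m s) -> t = s.

Definition simple_product k g := exists S : seq 'M[R]_n,
  [/\ forall s, s \in S -> simple s, size S = k & g = \big[mulmx/1%:M]_(s <- S) s].

Lemma simple_productM k l g h : simple_product k g -> simple_product l h ->
  simple_product (k + l) (g *m h).
Proof.
move=> [S [hS <- ->]] [T [hT <- ->]]; exists (S ++ T); split.
- by move=> s; rewrite mem_cat => /orP[/hS|/hT].
- exact: size_cat.
- by rewrite prod_mulmx_cat.
Qed.

Lemma simple_product1 s : simple s -> simple_product 1 s.
Proof.
move=> Ss; exists [:: s]; split=> // [t|]; first by rewrite inE => /eqP->.
by rewrite big_cons big_nil mulmx1.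
Qed.

Lemma simple_product0 : simple_product 0 1%:M.
Proof. by exists [::]; split=> //; rewrite big_nil. Qed.

Lemma simple_product_in k g : simple_product k g -> G g.
Proof.
move=> [S [hS _ ->]]; elim: S hS => [|s S IH] hS; first by rewrite big_nil; exact: mem_group1.
rewrite big_cons; apply: mem_groupM; first by case: (hS s (mem_head _ _)) => -[].
by apply: IH => t tS; apply: hS; rewrite inE tS orbT.
Qed.

(* Half the squared distance from [c] to the mirror image [c *m s]. *)
Let depth s : R := dot c c - dot (c *m s) c.

Let depth_root a : depth (1%:M - a^T *m a) = dot c a ^+ 2.
Proof. by rewrite /depth mul_reflection dotBl dotZl (dotC a) expr2; ring. Qed.

(* If [s] separates [c] from [c *m t], then so does [t *m s *m t], and one of *)
(* the two, say [s], is strictly shallower than [t]; so is then [s *m t *m s]. *)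
Lemma shallower t : reflections G t -> ~ simple t ->
  exists s, [/\ reflections G s, depth s < depth t & depth (s *m t *m s) < depth t].
Proof.
move=> Rt nst.
have [s [Rs [sp sNt]]] : exists s, reflections G s /\ sep s c (c *m t) /\ s != t.
  apply: contrapT => h; apply: nst; split=> // s Rs sp; apply: contrapT => sNt.
  by apply: h; exists s; do 2!split=> //; apply/eqP.
have [a [aa ca sE]] := root_at Rs.
have [b [bb cb tE]] := root_at Rt.
pose y := dot a b.
have : dot c a * y > 0 /\ dot c a < dot c b * y.
  move: sp; rewrite sE sep_root tE mul_reflection dotBl dotZl (dotC b) -/y => sp.
  have h : dot c a < dot c b * y by move: sp; rewrite pmulr_rlt0 // subr_lt0.
  by split=> //; rewrite mulr_gt0 // -(pmulr_rgt0 _ cb) (lt_trans ca).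
have y2 : y < 2.
  have : 0 < dot (a - b) (a - b).
    rewrite dotvv_gt0 subr_eq0; apply: contraNneq sNt => ab.
    by rewrite sE tE ab.
  by rewrite dotBl !dotBr aa bb (dotC b) -/y; lra.
(* Isolates what is needed of the shallower root, which will be [a] or its image under [t] up to
   sign. *)
have core s' a' : reflections G s' -> s' = 1%:M - a'^T *m a' -> dot a' b = y ->
    0 < dot c a' -> dot c a' < dot c b -> 0 < y ->
  exists s, [/\ reflections G s, depth s < depth t & depth (s *m t *m s) < depth t].
  move=> Rs' s'E a'b ca' ca'b y0; exists s'; split=> //.
    by rewrite s'E tE !depth_root ltr_pXn2r // nnegrE ltW.
  have -> : s' *m t *m s' = 1%:M - (b *m s')^T *m (b *m s').
    have st : s'^T = s' by apply: trmx_reflection; case: Rs'.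
    rewrite tE mulmxBr mulmxBl mulmx1 reflection_involutive // trmx_mul st.
    by rewrite !mulmxA.
  rewrite depth_root tE depth_root s'E mul_reflection dotBr dotZr (dotC b) a'b.
  (* The difference of the two squares factors as [y * dot c a'] times
     [2 * dot c b - y * dot c a']. *)
  rewrite -subr_gt0 subr_sqr opprB addrCA subrr addr0 mulr_gt0 ?mulr_gt0 //.
  have : y * dot c a' < 2 * dot c b.
    by apply: (lt_trans (y := 2 * dot c a')); rewrite ?ltr_pM2r ?ltr_pM2l.
  lra.
case=> cay cab.
have y0 : 0 < y by rewrite -(pmulr_rgt0 _ ca).
have [lt|ge] := ltP (dot c a) (dot c b); first exact: (core s a).
(* The root [y *: b - a] is minus the image of [a] under [t]. Its product with [c] is positive by
   [cab], and below [dot c b] since [y < 2] and [dot c b <= dot c a]. *)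
apply: (core (t *m s *m t^T) (y *: b - a)).
- by apply: reflections_conj => //; case: Rt.
- have tT : t^T = t by apply: trmx_reflection; case: Rt.
  have -> : y *: b - a = - (a *m t) by rewrite tE mul_reflection opprB -/y.
  rewrite tT [(- _)^T]raddfN /= mulNmx mulmxN opprK trmx_mul tT sE.
  by rewrite mulmxBr mulmxBl mulmx1 reflection_involutive // !mulmxA.
- by rewrite dotBl dotZl bb -/y; ring.
- by rewrite dotBr dotZr mulrC subr_gt0.
- rewrite dotBr dotZr.
  have : y * dot c b < 2 * dot c b by rewrite ltr_pM2r.
  lra.
- exact: y0.
Qed.

Lemma reflection_simple_product t : reflections G t -> exists k, simple_product k t.
Proof.
have /finite_seqP[F GF] : finite_set G by case: HG.
(* Depths are real numbers, so the induction runs on the number of shallower entries of [F]. *)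
pose N t := count (fun r => depth r < depth t) F.
have NP r w : reflections G r -> depth r < depth w -> (N r < N w)%N.
  move=> [Gr _] dr; rewrite /N.
  have /perm_to_rem rF : r \in F by move: Gr; rewrite GF.
  rewrite !(permP rF) /= ltxx dr add0n add1n ltnS.
  by apply: sub_count => x /= /lt_trans; apply.
have [m] := ubnP (N t); elim: m t => // m IH t Nm Rt.
have [st|nst] := pselect (simple t); first by exists 1%N; exact: simple_product1.
have [s [Rs dst dsts]] := shallower Rt nst.
have Rsts : reflections G (s *m t *m s).
  have -> : s *m t *m s = s *m t *m s^T.
    by rewrite trmx_reflection //; case: Rs.
  by apply: reflections_conj => //; case: Rs.
have [|k ks] := IH s _ Rs; first exact: leq_trans (NP _ _ Rs dst) _.
have [|l ls] := IH _ _ Rsts; first exact: leq_trans (NP _ _ Rsts dsts) _.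
exists (k + (l + k))%N.
have -> : t = s *m ((s *m t *m s) *m s).
  rewrite -!mulmxA (reflection_involutive Rs) mulmx1 !mulmxA.
  by rewrite reflection_involutive // mul1mx.
by apply: simple_productM => //; apply: simple_productM.
Qed.

Lemma group_simple_product g : G g -> exists k, simple_product k g.
Proof.
case: HG => _ _ gen /gen[S hS ->].
elim: S hS => [|s S IH] hS.
  by exists 0%N; rewrite big_nil; exact: simple_product0.
have [k ks] := reflection_simple_product (hS s (mem_head _ _)).
have [|l lS] := IH; first by move=> t tS; apply: hS; rewrite inE tS orbT.
by exists (k + l)%N; rewrite big_cons; apply: simple_productM.
Qed.

(** Induction on the word, splitting off its first letter [t] from the rest [w']. If [s] already
    separates [c] from [c *m w'], recurse; otherwise its hyperplane is crossed exactly in passing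
    from [c *m w'] to [c *m t *m w'], and then [t *m w' *m s] is [w']. *)
Lemma exchange k w s : reflections G s -> simple_product k w -> sep s c (c *m w) ->
  exists2 l, (l < k)%N & simple_product l (w *m s).
Proof.
move=> Rs [S [hS <- ->]]; elim: S hS => [|t S IH] hS.
  by rewrite big_nil mulmx1 => h; move: (root_at Rs) h => [a [_ ca ->]];
     rewrite sep_root ltNge -expr2 sqr_ge0.
have St := hS t (mem_head _ _).
have hS' r : r \in S -> simple r by move=> rS; apply: hS; rewrite inE rS orbT.
have pS : simple_product (size S) (\big[mulmx/1%:M]_(s <- S) s) by exists S.
rewrite big_cons /=; move: IH pS; set w' := \big[_/_]_(_ <- _) _ => IH pS.
have Gw' := simple_product_in pS.
have [sp|nsp] := boolP (sep s c (c *m w')).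
  have [l lS ls] := IH hS' sp; exists l.+1; rewrite ?ltnS //.
  by rewrite -mulmxA -add1n; apply: simple_productM => //; exact: simple_product1.
move=> sp; exists (size S) => //.
have Rs' : reflections G (w' *m s *m w'^T) by exact: reflections_conj.
(* Transported back by the inverse of [w'], the hyperplane of [s] lies between [c] and [c *m t], so
   simplicity of [t] applies. *)
have e : w' *m s *m w'^T = t.
  apply: (proj2 St) => //.
  have [a [aa ca sE]] := root_at Rs.
  move: sp nsp; rewrite sE sep_root sep_root => sp nsp.
  have -> : w' *m (1%:M - a^T *m a) *m w'^T = 1%:M - (a *m w'^T)^T *m (a *m w'^T).
    by rewrite mulmxBr mulmxBl mulmx1 group_mulmxT // trmx_mul trmxK !mulmxA.
  rewrite sep_root -!(dot_mulmx _ _ w') -mulmxA.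
  move: nsp; rewrite -leNgt pmulr_rge0 // => nsp.
  move: sp; rewrite pmulr_rlt0 // => sp.
  (* Otherwise the conjugate of [s] would fix the general point [c]; this makes the separation
     strict. *)
  have : dot (c *m w') a != 0.
    have := generalP Rs'; apply: contraNneq => h.
    rewrite -mulmxA sE mulmxA mulmxA mul_reflection h scale0r subr0.
    by rewrite -mulmxA group_mulmxT // mulmx1.
  by move=> nz; rewrite pmulr_rlt0 // lt_neqAle eq_sym nz.
have -> : t *m w' *m s = w'; last by [].
have e' : w' *m s = t *m w' by rewrite -e -mulmxA group_mulTmx // mulmx1.
by rewrite -mulmxA e' mulmxA reflection_involutive ?mul1mx //; case: St.
Qed.

(** Descent on word length: if [g] is [w *m s] with last letter [s] and fixes [c], then
    [c *m w = c *m s] is separated from [c] by [s], and [exchange] writes [g] with fewer letters. *)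
Theorem general_stabilizer g : G g -> c *m g = c -> g = 1%:M.
Proof.
move=> /group_simple_product[k]; have [m] := ubnP k.
elim: m k g => // m IH k g km [S [hS Sk gE]] cg.
case: (lastP S) hS Sk gE => [|S' s] hS Sk gE; first by rewrite gE big_nil.
move: Sk gE; rewrite size_rcons -cats1 prod_mulmx_cat big_cons big_nil mulmx1 /= => Sk gE.
have Ss : simple s by apply: hS; rewrite mem_rcons mem_head.
have Rs : reflections G s by case: Ss.
have pS : simple_product (size S') (\big[mulmx/1%:M]_(s <- S') s).
  by exists S'; split=> // t tS; apply: hS; rewrite mem_rcons inE tS orbT.
move: pS gE; set w := \big[_/_]_(_ <- _) _ => pS gE.
have cw : c *m w = c *m s.
  by rewrite -[in RHS]cg gE !mulmxA -mulmxA reflection_involutive // mulmx1.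
have [|l lS lw] := exchange Rs pS.
  have [a [aa ca sE]] := root_at Rs.
  rewrite cw sE sep_root mul_reflection dotBl dotZl aa pmulr_rlt0 //.
  lra.
rewrite gE; apply: (IH l) => //; last by rewrite -gE.
by rewrite -ltnS (leq_trans _ km) // -Sk !ltnS ltnW.
Qed.

End BasePoint.
End Chambers.

(** * Polynomial functions and strict differentiability *)

Section EuclideanNorm.
Variables (R : realType) (n : nat).
Implicit Types (u v w : 'rV[R]_n).

Lemma enorm_ge0 u : 0 <= enorm u. Proof. exact: sqrtr_ge0. Qed.

Lemma sqr_enorm u : enorm u ^+ 2 = dot u u.
Proof. by rewrite enormE sqr_sqrtr ?dotvv_ge0. Qed.

Lemma enorm0 : enorm (0 : 'rV[R]_n) = 0.
Proof. by rewrite enormE dot0l sqrtr0. Qed.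

Lemma enorm_eq0 u : (enorm u == 0) = (u == 0).
Proof. by rewrite -sqrf_eq0 sqr_enorm dotvv_eq0. Qed.

Lemma enorm_gt0 u : (0 < enorm u) = (u != 0).
Proof. by rewrite lt_neqAle enorm_ge0 andbT eq_sym enorm_eq0. Qed.

Lemma enormZ (a : R) u : enorm (a *: u) = `|a| * enorm u.
Proof. by rewrite !enormE dotZl dotZr mulrA -expr2 sqrtrM ?sqr_ge0 // sqrtr_sqr. Qed.

Lemma enormN u : enorm (- u) = enorm u.
Proof. by rewrite -scaleN1r enormZ normrN1 mul1r. Qed.

Lemma enormB u v : enorm (u - v) = enorm (v - u).
Proof. by rewrite -enormN opprB. Qed.

Lemma dot_le_enorm u v : `|dot u v| <= enorm u * enorm v.
Proof.
have [->|v0] := eqVneq v 0; first by rewrite dotC dot0l normr0 mulr_ge0 ?enorm_ge0.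
rewrite -(@ler_pXn2r _ 2) ?nnegrE ?mulr_ge0 ?enorm_ge0 //.
rewrite exprMn !sqr_enorm real_normK ?num_real // -subr_ge0.
have := dotvv_ge0 (dot v v *: u - dot u v *: v).
rewrite dotBl !dotBr !dotZl !dotZr (dotC v u).
set a := dot u u; set b := dot v v; set c := dot u v => h.
have b0 : 0 < b by rewrite dotvv_gt0.
rewrite -(pmulr_rge0 _ b0); apply: le_trans h _.
by rewrite le_eqVlt; apply/orP; left; apply/eqP; ring.
Qed.

Lemma enormD u v : enorm (u + v) <= enorm u + enorm v.
Proof.
rewrite -(@ler_pXn2r _ 2) ?nnegrE ?addr_ge0 ?enorm_ge0 //.
rewrite sqrrD !sqr_enorm dotDl !dotDr (dotC v u).
have := le_trans (ler_norm _) (dot_le_enorm u v); lra.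
Qed.

Lemma enorm_dist u v w : enorm (u - w) <= enorm (u - v) + enorm (v - w).
Proof. by apply: le_trans (enormD _ _); rewrite addrA subrK. Qed.

Lemma enorm_coord u i : `|u 0 i| <= enorm u.
Proof.
rewrite -(@ler_pXn2r _ 2) ?nnegrE ?enorm_ge0 // sqr_enorm real_normK ?num_real //.
rewrite dotE (bigD1 i) //= expr2 lerDl; apply: sumr_ge0 => j _.
by rewrite -expr2 sqr_ge0.
Qed.

Lemma enorm_le_sum u : enorm u <= \sum_i `|u 0 i|.
Proof.
rewrite -(@ler_pXn2r _ 2) ?nnegrE ?enorm_ge0 ?sumr_ge0 // sqr_enorm dotE.
rewrite expr2 mulr_suml; apply: ler_sum => i _.
rewrite -[X in X <= _]ger0_norm -?expr2 ?sqr_ge0 // expr2 normrM ler_wpM2l //.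
by rewrite (bigD1 i) //= lerDl sumr_ge0.
Qed.

End EuclideanNorm.

Lemma enorm_mulmx (R : realType) m n (A : 'M[R]_(m, n)) :
  exists2 C, 0 < C & forall v, enorm (v *m A) <= C * enorm v.
Proof.
exists (1 + \sum_j enorm (col j A)^T) => [|v].
  by rewrite ltr_pwDl // sumr_ge0 // => i _; exact: enorm_ge0.
apply: le_trans (enorm_le_sum _) _; rewrite mulrDl mul1r mulr_suml.
apply: (@le_trans _ _ (\sum_j enorm (col j A)^T * enorm v)).
  apply: ler_sum => j _; rewrite mulrC; apply: le_trans (dot_le_enorm _ _).
  rewrite dotE le_eqVlt; apply/orP; left; apply/eqP; rewrite !mxE.
  by congr `|_|; apply: eq_bigr => i _; rewrite !mxE.
by rewrite lerDr enorm_ge0.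
Qed.

(** Induction principle behind continuity, gradients and restriction to rays. As [phi] is arbitrary,
    it also covers polynomials in the basic invariants. *)
Lemma meval_ind (R : comNzRingType) (T : Type) k (P : (T -> R) -> Prop) :
  (forall c, P (fun=> c)) ->
  (forall f g, P f -> P g -> P (fun x => f x + g x)) ->
  (forall f g, P f -> P g -> P (fun x => f x * g x)) ->
  forall phi : 'I_k -> T -> R, (forall i, P (phi i)) ->
  forall h : mpoly k R, P (fun x => meval (fun i => phi i x) h).
Proof.
move=> Pc PD PM phi Pphi h.
rewrite (_ : (fun x => _) = fun x => \sum_(m <- msupp h) mcoeff m h *
    \prod_i phi i x ^+ m i); last by apply/funext => x; rewrite mevalE.
have Psum (I : Type) (r : seq I) (F : I -> T -> R) :
    (forall i, P (F i)) -> P (fun x => \sum_(i <- r) F i x).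
  move=> PF; elim: r => [|i r IH].
    by rewrite (_ : (fun x => _) = fun=> 0) //; apply/funext => x; rewrite big_nil.
  rewrite (_ : (fun x => _) = fun x => F i x + \sum_(j <- r) F j x); first exact: PD.
  by apply/funext => x; rewrite big_cons.
have Pprod (I : Type) (r : seq I) (F : I -> T -> R) :
    (forall i, P (F i)) -> P (fun x => \prod_(i <- r) F i x).
  move=> PF; elim: r => [|i r IH].
    by rewrite (_ : (fun x => _) = fun=> 1) //; apply/funext => x; rewrite big_nil.
  rewrite (_ : (fun x => _) = fun x => F i x * \prod_(j <- r) F j x); first exact: PM.
  by apply/funext => x; rewrite big_cons.
apply: (Psum _ _ (fun m x => mcoeff m h * \prod_i phi i x ^+ m i)) => m.
apply: (PM (fun=> _)) => //; apply: (Pprod _ _ (fun i x => phi i x ^+ m i)) => i.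
elim: (m i) => [|d IH].
  by rewrite (_ : (fun x => _) = fun=> 1) //; apply/funext => x; rewrite expr0.
rewrite (_ : (fun x => _) = fun x => phi i x * phi i x ^+ d); first exact: PM.
by apply/funext => x; rewrite exprS.
Qed.

Lemma continuous_peval (R : realType) n (f : mpoly n R) : continuous (peval f).
Proof.
apply: (@meval_ind R 'rV[R]_n n (fun f => continuous f) _ _ _ (fun i v => v 0 i)).
- by move=> c; exact: cst_continuous.
- by move=> g h cg ch x; apply: continuousD; [exact: cg|exact: ch].
- by move=> g h cg ch x; apply: continuousM; [exact: cg|exact: ch].
- by move=> i; exact: coord_continuous.
Qed.

(** Polynomial sublevel sets are closed, hence compact when bounded; both balls and spheres have
    this form. *)
Lemma peval_attains_min (R : realType) n (f h : mpoly n R) (M : R) x0 :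
  (forall x, peval h x <= 0 -> enorm x <= M) -> peval h x0 <= 0 ->
  exists2 x, peval h x <= 0 & forall y, peval h y <= 0 -> peval f x <= peval f y.
Proof.
move=> hM hx0; pose A := [set x : 'rV[R]_n | peval h x <= 0].
have Acl : closed A.
  apply: (@preimage_closed _ _ (peval h) [set y | y <= 0]); last exact: closed_le.
  by move=> x _; exact: continuous_peval.
have Abd : bounded_set A.
  exists M; split; first exact: num_real.
  move=> M' MM' x /hM xM; apply: le_trans (ltW MM').
  have x0' : 0 <= M by apply: le_trans (enorm_ge0 _) xM.
  rewrite [leLHS]/Num.norm /= mx_normrE.
  apply/Order.TotalTheory.bigmax_leP; split=> // -[i j] _ /=.
  by rewrite (ord1 i); apply: le_trans (enorm_coord _ _) _.
have [||c cA cmin] := @compact_EVT_min _ R (peval f) A _ (bounded_closed_compact Abd Acl).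
- by exists x0.
- by apply: continuous_subspaceT; exact: continuous_peval.
by exists c => [|y hy]; [rewrite inE in cA|apply: cmin; rewrite inE].
Qed.

Section StrictDifferentiability.
Variables (R : realType) (n : nat).
Implicit Types (f g : 'rV[R]_n -> R) (p a b x y u v w : 'rV[R]_n).

(* [f] is strictly differentiable at [p] with gradient [a]. *)
Definition sdiff f p a := forall e, 0 < e -> exists2 r, 0 < r &
  forall x y, enorm (x - p) < r -> enorm (y - p) < r ->
    `|f x - f y - dot (x - y) a| <= e * enorm (x - y).

Lemma sdiff_cst c p : sdiff (fun=> c) p 0.
Proof.
move=> e e0; exists 1 => // x y _ _.
by rewrite dotC dot0l subrr subr0 normr0 mulr_ge0 ?enorm_ge0 ?ltW.
Qed.

Lemma sdiff_dot v p : sdiff (fun x => dot x v) p v.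
Proof.
move=> e e0; exists 1 => // x y _ _.
by rewrite dotBl subrr normr0 mulr_ge0 ?enorm_ge0 ?ltW.
Qed.

Lemma sdiff_coord i p : sdiff (fun x => x 0 i) p (delta_mx 0 i).
Proof.
rewrite (_ : (fun x => _) = fun x => dot x (delta_mx 0 i)); first exact: sdiff_dot.
apply/funext => x; rewrite dotE (bigD1 i) //= mxE !eqxx mulr1 big1 ?addr0 // => j ji.
by rewrite mxE (negPf ji) andbF mulr0.
Qed.

Lemma sdiffD f g p a b : sdiff f p a -> sdiff g p b ->
  sdiff (fun x => f x + g x) p (a + b).
Proof.
move=> fa gb e e0.
have e2 : 0 < e / 2 by rewrite divr_gt0.
have [r r0 fr] := fa _ e2; have [s s0 gs] := gb _ e2.
exists (Num.min r s); first by rewrite lt_min r0.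
move=> x y; rewrite !lt_min => /andP[xr xs] /andP[yr ys].
rewrite dotDr (_ : _ - _ =
  (f x - f y - dot (x - y) a) + (g x - g y - dot (x - y) b)); last by ring.
apply: le_trans (ler_normD _ _) _.
by rewrite [e in e * _]splitr mulrDl lerD ?fr ?gs.
Qed.

Lemma sdiff_continuous f p a : sdiff f p a -> forall e, 0 < e ->
  exists2 r, 0 < r & forall x, enorm (x - p) < r -> `|f x - f p| <= e.
Proof.
move=> fa e e0; have [r r0 fr] := fa 1 ltr01.
pose C := 1 + enorm a; have C0 : 0 < C by rewrite ltr_pwDl // enorm_ge0.
exists (Num.min r (e / C)); first by rewrite lt_min r0 divr_gt0.
move=> x; rewrite lt_min => /andP[xr xe].
have := fr x p xr; rewrite subrr enorm0 => /(_ r0) h.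
rewrite -(subrK (dot (x - p) a) (f x - f p)).
apply: le_trans (ler_normD _ _) _.
have h2 : C * enorm (x - p) <= e by rewrite mulrC -ler_pdivlMr // ltW.
apply: le_trans h2; rewrite /C mulrDl lerD // mulrC; exact: dot_le_enorm.
Qed.

Lemma sdiffM f g p a b : sdiff f p a -> sdiff g p b ->
  sdiff (fun x => f x * g x) p (f p *: b + g p *: a).
Proof.
move=> fa gb e e0.
(* The error splits into four terms, at most [d * E] times [1 + |f p|], [enorm b], [1 + |g p|] and
   [enorm a]; these factors add up to at most [2 * K]. *)
pose K := 1 + `|f p| + `|g p| + enorm a + enorm b.
have K0 : 0 < K by rewrite /K !ltr_wpDr ?enorm_ge0.
pose d := Num.min 1 (e / (2 * K)).
have d0 : 0 < d by rewrite lt_min ltr01 divr_gt0 // mulr_gt0.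
have d1 : d <= 1 by rewrite ge_min lexx.
have dK : 2 * K * d <= e.
  by rewrite mulrC -ler_pdivlMr ?mulr_gt0 // ge_min lexx orbT.
have [r r0 fr] := fa _ d0; have [s s0 gs] := gb _ d0.
have [r' r'0 fc] := sdiff_continuous fa d0; have [s' s'0 gc] := sdiff_continuous gb d0.
exists (Num.min (Num.min r s) (Num.min r' s')); first by rewrite !lt_min r0 s0 r'0.
move=> x y; rewrite !lt_min => /andP[/andP[xr xs] /andP[xr' xs']].
move=> /andP[/andP[yr ys] /andP[yr' ys']].
have {fr}Hf := fr x y xr yr; have {gs}Hg := gs x y xs ys.
have {fc}Cf := fc x xr'; have {gc}Cg := gc y ys'.
have Da := dot_le_enorm (x - y) a; have Db := dot_le_enorm (x - y) b.
set E := enorm (x - y) in Hf Hg Da Db *.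
have E0 : 0 <= E by exact: enorm_ge0.
rewrite dotDr !dotZr (_ : _ - _ = f x * (g x - g y - dot (x - y) b)
   + (f x - f p) * dot (x - y) b + g y * (f x - f y - dot (x - y) a)
   + (g y - g p) * dot (x - y) a); last by ring.
have fx : `|f x| <= `|f p| + 1.
  rewrite -[f x](subrK (f p)) addrC; apply: le_trans (ler_normD _ _) _.
  by rewrite lerD2l (le_trans Cf).
have gy : `|g y| <= `|g p| + 1.
  rewrite -[g y](subrK (g p)) addrC; apply: le_trans (ler_normD _ _) _.
  by rewrite lerD2l (le_trans Cg).
have dE0 : 0 <= d * E by rewrite mulr_ge0 // ltW.
have H1 : `|f x * (g x - g y - dot (x - y) b)| <= (`|f p| + 1) * (d * E).
  by rewrite normrM ler_pM.
have H2 : `|(f x - f p) * dot (x - y) b| <= d * (E * enorm b).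
  by rewrite normrM ler_pM.
have H3 : `|g y * (f x - f y - dot (x - y) a)| <= (`|g p| + 1) * (d * E).
  by rewrite normrM ler_pM.
have H4 : `|(g y - g p) * dot (x - y) a| <= d * (E * enorm a).
  by rewrite normrM ler_pM.
apply: le_trans (ler_normD _ _) _; apply: le_trans (lerD (ler_normD _ _) H4) _.
apply: le_trans (lerD (lerD (ler_normD _ _) H3) (lexx _)) _.
apply: le_trans (lerD (lerD (lerD H1 H2) (lexx _)) (lexx _)) _.
apply: (@le_trans _ _ (2 * K * (d * E))); last by rewrite mulrA ler_wpM2r.
rewrite (_ : _ + _ = (2 + `|f p| + `|g p| + enorm a + enorm b) * (d * E)); last by ring.
rewrite ler_wpM2r // /K.
have := enorm_ge0 a; have := enorm_ge0 b; have := normr_ge0 (f p); have := normr_ge0 (g p).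
lra.
Qed.

Lemma sdiff_peval (f : mpoly n R) p : exists a, sdiff (peval f) p a.
Proof.
apply: (@meval_ind R 'rV[R]_n n (fun f => exists a, sdiff f p a) _ _ _ (fun i v => v 0 i)).
- by move=> c; exists 0; exact: sdiff_cst.
- by move=> g h [a ga] [b hb]; exists (a + b); exact: sdiffD.
- by move=> g h [a ga] [b hb]; exists (g p *: b + h p *: a); exact: sdiffM.
- by move=> i; exists (delta_mx 0 i); exact: sdiff_coord.
Qed.

Lemma sdiff_mulmx f p a (g : 'M[R]_n) : sdiff f (p *m g) a ->
  sdiff (fun x => f (x *m g)) p (a *m g^T).
Proof.
move=> fa e e0; have [C C0 gC] := enorm_mulmx g.
have [r r0 fr] := fa (e / C) (divr_gt0 e0 C0).
exists (r / C); first exact: divr_gt0.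
move=> x y xr yr; rewrite -(trmxK g) -dot_mulmx trmxK mulmxBl.
have near z : enorm (z - p) < r / C -> enorm (z *m g - p *m g) < r.
  by rewrite -mulmxBl ltr_pdivlMr // mulrC; apply: le_lt_trans.
apply: le_trans (fr _ _ (near _ xr) (near _ yr)) _.
by rewrite -mulmxBl -mulrA ler_pM2l // mulrC ler_pdivrMr // mulrC gC.
Qed.

Lemma sdiff_unique f p a b : sdiff f p a -> sdiff f p b -> a = b.
Proof.
move=> fa fb; apply/eqP; rewrite -subr_eq0; apply/negPn/negP => ab0.
set w := a - b in ab0; have w0 : 0 < enorm w by rewrite enorm_gt0.
(* With this tolerance, a small step along [w] would have inner product with [w] at most half its
   actual value. *)
have e0 : 0 < enorm w / 4 by rewrite divr_gt0.
have [r r0 fr] := fa _ e0; have [s s0 fs] := fb _ e0.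
pose m := Num.min r s; have m0 : 0 < m by rewrite lt_min r0.
pose k := m / 2 / enorm w; have k0 : 0 < k by rewrite !divr_gt0.
have kw : enorm (p + k *: w - p) < m.
  rewrite addrC addKr enormZ gtr0_norm // /k divfK ?gt_eqF //.
  by rewrite ltr_pdivrMr // mulr_natr mulr2n ltrDl.
have [kr ks] : enorm (p + k *: w - p) < r /\ enorm (p + k *: w - p) < s.
  by split; apply: lt_le_trans kw _; rewrite ge_min lexx ?orbT.
have h1 := fr _ p kr; have h2 := fs _ p ks.
move: h1 h2; rewrite subrr enorm0 => /(_ r0) h1 /(_ s0) h2.
have : `|dot (p + k *: w - p) w| <= enorm w / 2 * enorm (p + k *: w - p).
  rewrite {1}/w dotBr (_ : _ - _ = (f (p + k *: w) - f p - dot (p + k *: w - p) b) -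
    (f (p + k *: w) - f p - dot (p + k *: w - p) a)); last by ring.
  apply: le_trans (ler_normB _ _) _; lra.
rewrite addrC addKr dotZl enormZ gtr0_norm; last first.
  by rewrite mulr_gt0 // dotvv_gt0.
rewrite gtr0_norm // -sqr_enorm.
have : 0 < k * enorm w ^+ 2 by rewrite mulr_gt0 // exprn_gt0.
lra.
Qed.

End StrictDifferentiability.

Section PolynomialFunctions.
Variables (R : realType) (n : nat).
Implicit Types (f g : 'rV[R]_n -> R) (u v x : 'rV[R]_n).

Definition polyfun f := exists F : mpoly n R, f = peval F.

Lemma polyfun_peval (F : mpoly n R) : polyfun (peval F).
Proof. by exists F. Qed.

Lemma polyfun_cst c : polyfun (fun=> c).
Proof. by exists (mpolyC n c); apply/funext => x; rewrite /peval mevalC. Qed.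

Lemma polyfunD f g : polyfun f -> polyfun g -> polyfun (fun x => f x + g x).
Proof.
by move=> [F ->] [K ->]; exists (F + K); apply/funext => x; rewrite /peval mevalD.
Qed.

Lemma polyfunM f g : polyfun f -> polyfun g -> polyfun (fun x => f x * g x).
Proof.
by move=> [F ->] [K ->]; exists (F * K); apply/funext => x; rewrite /peval mevalM.
Qed.

Lemma polyfunX f k : polyfun f -> polyfun (fun x => f x ^+ k).
Proof.
by move=> [F ->]; exists (F ^+ k); apply/funext => x; rewrite /peval rmorphXn.
Qed.

Lemma polyfun_coord i : polyfun (fun x => x 0 i).
Proof. by exists (mpolyX R (mnm1 i)); apply/funext => x; rewrite /peval mevalXU. Qed.

Lemma polyfun_sum (I : Type) (r : seq I) (F : I -> 'rV[R]_n -> R) :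
  (forall i, polyfun (F i)) -> polyfun (fun x => \sum_(i <- r) F i x).
Proof.
move=> PF; elim: r => [|i r IH].
  rewrite (_ : (fun x => _) = fun=> 0); first exact: polyfun_cst.
  by apply/funext => x; rewrite big_nil.
rewrite (_ : (fun x => _) = fun x => F i x + \sum_(j <- r) F j x); first exact: polyfunD.
by apply/funext => x; rewrite big_cons.
Qed.

Lemma polyfun_prod (I : Type) (r : seq I) (F : I -> 'rV[R]_n -> R) :
  (forall i, polyfun (F i)) -> polyfun (fun x => \prod_(i <- r) F i x).
Proof.
move=> PF; elim: r => [|i r IH].
  rewrite (_ : (fun x => _) = fun=> 1); first exact: polyfun_cst.
  by apply/funext => x; rewrite big_nil.
rewrite (_ : (fun x => _) = fun x => F i x * \prod_(j <- r) F j x); first exact: polyfunM.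
by apply/funext => x; rewrite big_cons.
Qed.

Lemma polyfun_dot v : polyfun (fun x => dot x v).
Proof.
rewrite (_ : (fun x => _) = fun x => \sum_i x 0 i * v 0 i); last first.
  by apply/funext => x; rewrite dotE.
apply: (polyfun_sum _ (F := fun i x => x 0 i * v 0 i)) => i.
apply: polyfunM (polyfun_coord i) (polyfun_cst _).
Qed.

Lemma polyfun_sqnorm v : polyfun (fun x => dot (x - v) (x - v)).
Proof.
rewrite (_ : (fun x => _) = fun x => \sum_i (x 0 i + - v 0 i) ^+ 2); last first.
  by apply/funext => x; rewrite dotE; apply: eq_bigr => i _; rewrite !mxE.
apply: (polyfun_sum _ (F := fun i x => (x 0 i + - v 0 i) ^+ 2)) => i.
exact/polyfunX/polyfunD/polyfun_cst/polyfun_coord.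
Qed.

Lemma polyfun_mulmx f (g : 'M[R]_n) : polyfun f -> polyfun (fun x => f (x *m g)).
Proof.
move=> [F ->]; rewrite /peval.
apply: (@meval_ind R 'rV[R]_n n polyfun _ _ _ (fun i x => (x *m g) 0 i)) => [c|h k|h k|i].
- exact: polyfun_cst.
- exact: polyfunD.
- exact: polyfunM.
rewrite (_ : (fun x => _) = fun x => dot x (col i g)^T); first exact: polyfun_dot.
by apply/funext => x; rewrite dotE !mxE; apply: eq_bigr => j _; rewrite !mxE.
Qed.

Lemma polyfun_attains_min f h (M : R) x0 : polyfun f -> polyfun h ->
  (forall x, h x <= 0 -> enorm x <= M) -> h x0 <= 0 ->
  exists2 x, h x <= 0 & forall y, h y <= 0 -> f x <= f y.
Proof. by move=> [F ->] [H ->]; exact: peval_attains_min. Qed.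

Lemma sdiff_polyfun f p : polyfun f -> exists a, sdiff f p a.
Proof. by move=> [F ->]; exact: sdiff_peval. Qed.

End PolynomialFunctions.

(** * Local surjectivity of a polynomial map with invertible derivative *)

Section LocalSurjection.
Variables (R : realType) (n : nat) (phi : 'I_n -> 'rV[R]_n -> R) (p : 'rV[R]_n).
Hypothesis poly_phi : forall i, polyfun (phi i).
Variable A : 'M[R]_n.
Hypothesis A_unit : A \in unitmx.
Hypothesis phi_A : forall i, sdiff (phi i) p (row i A).

Let Phi x : 'rV[R]_n := \row_i phi i x.

(** Strictness matters here: the estimate compares any two points near [p], so a Newton step may
    start away from [p]. *)
Lemma row_sdiff e : 0 < e -> exists2 r, 0 < r &
  forall x y, enorm (x - p) < r -> enorm (y - p) < r ->
    enorm (Phi x - Phi y - (x - y) *m A^T) <= e * enorm (x - y).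
Proof.
move=> e0; have d0 : 0 < e / n.+1%:R by rewrite divr_gt0.
have /choice[r Hr] : forall i, exists r, 0 < r /\
  forall x y, enorm (x - p) < r -> enorm (y - p) < r ->
    `|phi i x - phi i y - dot (x - y) (row i A)| <= e / n.+1%:R * enorm (x - y).
  by move=> i; have [r r0 h] := phi_A i d0; exists r.
exists (\big[Num.min/1]_i r i).
  by elim/big_ind: _ => // [x y x0 y0|i _]; [rewrite lt_min x0|case: (Hr i)].
move=> x y xr yr; apply: le_trans (enorm_le_sum _) _.
apply: (@le_trans _ _ (\sum_(i < n) e / n.+1%:R * enorm (x - y))); last first.
  rewrite sumr_const card_ord -[_ *+ n]mulr_natr (mulrAC _ (enorm _)) ler_wpM2r ?enorm_ge0 //.
  by rewrite mulrAC ler_pdivrMr // ler_pM2l // ler_nat.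
apply: ler_sum => i _; have [_ /(_ x y)] := Hr i.
rewrite !mxE; set s := \sum_j _; have -> : s = dot (x - y) (row i A).
  by rewrite dotE /s; apply: eq_bigr => j _; rewrite !mxE.
by apply; [apply: lt_le_trans xr _|apply: lt_le_trans yr _]; apply: bigmin_le_cond.
Qed.

(* A closest point [Phi x] to [z] over a small ball around [p] equals [z]: *)
(* otherwise a Newton step from [x] gets closer. *)
Lemma local_surjection e : 0 < e -> exists2 d, 0 < d &
  forall z : 'rV[R]_n, enorm (z - Phi p) < d ->
    exists2 x, enorm (x - p) < e & Phi x = z.
Proof.
move=> e0; have [C C0 hC] := enorm_mulmx (invmx A^T).
have AT : A^T \in unitmx by rewrite unitmx_tr.
(* As [C] bounds the inverse derivative, the linearization error is at most half of what a Newton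
   step gains. *)
have [|r r0 hr] := @row_sdiff (2 * C)^-1; first by rewrite invr_gt0 mulr_gt0.
pose q := Num.min (r / 2) (e / 2); have q0 : 0 < q by rewrite lt_min !divr_gt0.
have qr : q < r by rewrite gt_min ltr_pdivrMr // mulr_natr mulr2n ltrDl r0.
have qe : q < e by rewrite gt_min [e / 2 < e]ltr_pdivrMr // mulr_natr mulr2n ltrDl e0 orbT.
have inj x : enorm (x - p) < r -> enorm (x - p) <= 2 * C * enorm (Phi x - Phi p).
  move=> xr; have := hr x p xr; rewrite subrr enorm0 => /(_ r0) h.
  have : enorm (x - p) <= C * enorm ((x - p) *m A^T).
    by rewrite -{1}(mulmxK AT (x - p)).
  have : enorm ((x - p) *m A^T) <= enorm (Phi x - Phi p) + (2 * C)^-1 * enorm (x - p).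
    rewrite -[X in enorm X <= _](subrK (Phi x - Phi p)) addrC.
    by apply: le_trans (enormD _ _) _; rewrite lerD2l enormB.
  rewrite -(ler_pM2l C0) => h1 h2; have := le_trans h2 h1.
  rewrite mulrDr mulrA invfM mulrCA divff ?gt_eqF // mulr1.
  by move: (enorm _) (enorm _) => a b; lra.
exists (q / (4 * C)) => [|z hz]; first by rewrite divr_gt0 // mulr_gt0.
have [||||x xq xmin] := @polyfun_attains_min R n
    (fun x => \sum_i (phi i x + - z 0 i) ^+ 2)
    (fun x => dot (x - p) (x - p) + - q ^+ 2) (q + enorm p) p.
- apply: (polyfun_sum _ (F := fun i x => (phi i x + - z 0 i) ^+ 2)) => i.
  exact/polyfunX/polyfunD/polyfun_cst.
- exact/polyfunD/polyfun_cst/polyfun_sqnorm.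
- move=> x; rewrite subr_le0 -sqr_enorm ler_pXn2r ?nnegrE ?enorm_ge0 ?(ltW q0) // => xq.
  by rewrite -[x in enorm x <= _](subrK p); apply: le_trans (enormD _ _) _; rewrite lerD2r.
- by rewrite subrr dot0l add0r oppr_le0 sqr_ge0.
have objE y : \sum_i (phi i y + - z 0 i) ^+ 2 = enorm (Phi y - z) ^+ 2.
  by rewrite sqr_enorm dotE; apply: eq_bigr => i _; rewrite !mxE.
have {}xmin y : enorm (y - p) <= q -> enorm (Phi x - z) <= enorm (Phi y - z).
  move=> yq; have := xmin y; rewrite !objE => h.
  rewrite -(@ler_pXn2r _ 2) ?nnegrE ?enorm_ge0 //; apply: h.
  by rewrite subr_le0 -sqr_enorm ler_pXn2r ?nnegrE ?enorm_ge0 ?(ltW q0).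
move: xq; rewrite subr_le0 -sqr_enorm ler_pXn2r ?nnegrE ?enorm_ge0 ?(ltW q0) // => xq.
have xr := le_lt_trans xq qr.
(* The minimizer is interior: on the boundary, [inj] and comparison with [p] would give
   [q <= 4 * C * enorm (z - Phi p)], which is less than [q]. *)
have {}xq : enorm (x - p) < q.
  rewrite lt_neqAle xq andbT; apply/eqP => xqE.
  have := inj x xr; rewrite xqE => h.
  have : enorm (Phi x - Phi p) <= enorm (Phi x - z) + enorm (z - Phi p).
    exact: enorm_dist.
  have := xmin p; rewrite subrr enorm0 => /(_ (ltW q0)); rewrite (enormB (Phi p)).
  move=> h1 h2; have h3 : enorm (Phi x - Phi p) <= 2 * enorm (z - Phi p) by lra.
  move: hz; rewrite ltr_pdivlMr ?mulr_gt0 // => hz.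
  have : 2 * C * enorm (Phi x - Phi p) <= 2 * C * (2 * enorm (z - Phi p)).
    by rewrite ler_pM2l // mulr_gt0.
  rewrite (_ : 2 * C * (2 * enorm (z - Phi p)) = enorm (z - Phi p) * (4 * C)); last by ring.
  lra.
exists x; first exact: lt_trans xq qe.
apply/eqP; rewrite -subr_eq0 -enorm_eq0; apply/negPn/negP => w0.
pose w := z - Phi x; have {}w0 : 0 < enorm w by rewrite lt_neqAle enorm_ge0 eq_sym enormB w0.
pose v := w *m invmx A^T.
(* The Newton step [v] is damped by [s] to stay in the ball; the new residual is at most
   [(1 - s) + s / 2] times the old one. *)
have vC : enorm v <= C * enorm w by exact: hC.
have [s [s0 s1 hs]] : exists s, [/\ 0 < s, s <= 1 & s * (C * enorm w) <= q - enorm (x - p)].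
  have qx : 0 < q - enorm (x - p) by rewrite subr_gt0.
  exists (Num.min 1 ((q - enorm (x - p)) / (C * enorm w))); split.
  - by rewrite lt_min ltr01 divr_gt0 // mulr_gt0.
  - by rewrite ge_min lexx.
  - by rewrite -ler_pdivlMr ?mulr_gt0 // ge_min lexx orbT.
have sv : enorm (s *: v) <= s * (C * enorm w) by rewrite enormZ gtr0_norm // ler_pM2l.
have yq : enorm (x + s *: v - p) <= q.
  rewrite addrAC; apply: le_trans (enormD _ _) _.
  by move: hs; move: (enorm (x - p)) sv => ? ?; lra.
have := xmin _ yq; apply/negP; rewrite -ltNge.
have := hr (x + s *: v) x (le_lt_trans yq qr) xr.
rewrite (addrAC x) subrr add0r -scalemxAl mulmxKV // => h.
have -> : Phi (x + s *: v) - z = (Phi (x + s *: v) - Phi x - s *: w) + (s - 1) *: w.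
  by rewrite scalerBl scale1r /w addrA subrK opprB addrA subrK.
apply: le_lt_trans (enormD _ _) _; rewrite enormZ ler0_norm ?subr_le0 // opprB.
rewrite (enormB (Phi x)) -/w.
have : (2 * C)^-1 * enorm (s *: v) <= s * enorm w / 2.
  rewrite mulrC ler_pdivrMr ?mulr_gt0 //; apply: le_trans sv _.
  by rewrite le_eqVlt; apply/orP; left; apply/eqP; field.
move=> /(le_trans h) h'.
have sw : 0 < s * enorm w by rewrite mulr_gt0.
lra.
Qed.

End LocalSurjection.

(** * The orbit map at a general point *)

Section OrbitMap.
Variables (R : realType) (n : nat).
Implicit Types (p x y u v w : 'rV[R]_n).

Lemma sdiff_sqnorm v : sdiff (fun x => dot (x - v) (x - v)) v 0.
Proof.
move=> e e0; exists (e / 2) => [|x y xv yv]; first by rewrite divr_gt0.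
rewrite (dotC _ 0) dot0l subr0.
have -> : dot (x - v) (x - v) - dot (y - v) (y - v) = dot (x - y) ((x - v) + (y - v)).
  have -> : x - y = (x - v) - (y - v) by rewrite opprB addrA subrK.
  move: (x - v) (y - v) => a b.
  by rewrite dotBl !dotDr (dotC b a); ring.
apply: le_trans (dot_le_enorm _ _) _; rewrite mulrC ler_wpM2r ?enorm_ge0 //.
by apply: le_trans (enormD _ _) _; lra.
Qed.

Lemma sdiff_sum (I : eqType) (r : seq I) (F : I -> 'rV[R]_n -> R) (b : I -> 'rV[R]_n) p :
  (forall i, i \in r -> sdiff (F i) p (b i)) ->
  sdiff (fun x => \sum_(i <- r) F i x) p (\sum_(i <- r) b i).
Proof.
elim: r => [|i r IH] Fb.
  rewrite big_nil (_ : (fun x => _) = fun=> 0); first exact: sdiff_cst.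
  by apply/funext => x; rewrite big_nil.
rewrite big_cons (_ : (fun x => _) = fun x => F i x + \sum_(j <- r) F j x); last first.
  by apply/funext => x; rewrite big_cons.
apply: sdiffD; first by apply: Fb; rewrite mem_head.
by apply: IH => j jr; apply: Fb; rewrite inE jr orbT.
Qed.

Variables (G : set 'M[R]_n) (pi : n.-tuple (mpoly n R)).
Hypotheses (HG : reflection_group G) (Hpi : basic_invariants G pi).
Variable p : 'rV[R]_n.
Hypothesis Hp : general G p.

(* The average over [G] of [<x - p, w> * \prod_(g != 1) |x - p g|^2] only      *)
(* keeps the gradient of the term of index 1, as stabilizers are trivial. *)
Lemma invariant_with_gradient w : exists F (c : R),
  [/\ polyfun F, forall g x, G g -> F (x *m g) = F x, 0 < c & sdiff F p (c *: w)].
Proof.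
have /finite_seqP[s0 Gs0] : finite_set G by case: HG.
pose s := undup s0; have us : uniq s := undup_uniq _.
have Gs g : G g <-> g \in s by rewrite Gs0 /s mem_undup.
pose D x := \prod_(g <- s | g != 1%:M) dot (x - p *m g) (x - p *m g).
pose P x := dot x w + - dot p w.
have DE : D = fun x => \prod_(g <- [seq g <- s | g != 1%:M]) dot (x - p *m g) (x - p *m g).
  by apply/funext => x; rewrite /D big_filter.
have polyD : polyfun D.
  rewrite DE; apply: (polyfun_prod _ (F := fun g x => dot (x - p *m g) (x - p *m g))).
  by move=> g; exact: polyfun_sqnorm.
have polyP : polyfun P by exact/polyfunD/polyfun_cst/polyfun_dot.
have sP x : sdiff P x w.
  by rewrite -[w in sdiff _ _ w]addr0; apply: sdiffD; [exact: sdiff_dot|exact: sdiff_cst].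
have P0 : P p = 0 by rewrite /P subrr.
exists (fun x => \sum_(g <- s) P (x *m g) * D (x *m g)), (D p); split.
- apply: (polyfun_sum _ (F := fun g x => P (x *m g) * D (x *m g))) => g.
  by apply: polyfunM; apply: polyfun_mulmx.
- move=> g x Gg; under eq_bigr do rewrite -mulmxA.
  rewrite -(big_map (mulmx g) xpredT (fun h => P (x *m h) * D (x *m h))).
  apply: perm_big; apply: uniq_perm => //.
    rewrite map_inj_uniq // => h k /(congr1 (mulmx g^T)).
    by rewrite !mulmxA (group_mulTmx HG Gg) !mul1mx.
  move=> h; apply/mapP/idP => [[k /Gs Gk ->]|/Gs Gh]; first exact/Gs/(mem_groupM HG).
  exists (g^T *m h); last by rewrite mulmxA (group_mulmxT HG Gg) mul1mx.
  by apply/Gs/(mem_groupM HG) => //; exact: (mem_groupT HG).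
- rewrite /D big_seq_cond; apply: prodr_gt0 => g /andP[/Gs Gg g1].
  rewrite dotvv_gt0 subr_eq0; apply: contraNneq g1 => pg.
  by apply/eqP; apply: (general_stabilizer HG Hp Gg).
have G1s : 1%:M \in s by apply/Gs; exact: (mem_group1 HG).
have -> : D p *: w = \sum_(g <- s) if g == 1%:M then D p *: w else 0.
  by rewrite (bigD1_seq 1%:M) //= eqxx big1 ?addr0 // => g /negPf->.
apply: (sdiff_sum (F := fun g x => P (x *m g) * D (x *m g))) => g gs.
case: eqVneq => [->|g1].
  have [a sD] := sdiff_polyfun p polyD.
  have := sdiffM (sP p) sD; rewrite P0 scale0r add0r.
  by congr sdiff; apply/funext => x; rewrite mulmx1.
rewrite -(mul0mx _ g^T); apply: (@sdiff_mulmx _ _ (fun x => P x * D x)).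
(* The factor of index [g] vanishes to second order at [p *m g], so [D] has zero value and zero
   gradient there. *)
have [D' polyD' DD'] : exists2 D', polyfun D' &
    D = fun x => dot (x - p *m g) (x - p *m g) * D' x.
  exists (fun x => \prod_(h <- rem g [seq g <- s | g != 1%:M])
      dot (x - p *m h) (x - p *m h)).
    by apply: (polyfun_prod _ (F := fun g x => dot (x - p *m g) (x - p *m g))) => h;
       exact: polyfun_sqnorm.
  rewrite DE; apply/funext => x; apply: (big_rem g).
  by rewrite mem_filter g1.
have [a sD'] := sdiff_polyfun (p *m g) polyD'.
have sD : sdiff D (p *m g) 0.
  have := sdiffM (sdiff_sqnorm (p *m g)) sD'.
  by rewrite subrr dot0l scale0r scaler0 addr0 -DD'.
have := sdiffM (sP _) sD.
by rewrite [in D _]DD' subrr dot0l mul0r scale0r scaler0 addr0.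
Qed.

(** A nonzero [w] orthogonal to all these gradients would, by the chain rule, be orthogonal to the
    gradient at [p] of every invariant, but some invariant has a positive multiple of [w] as
    gradient. *)
Lemma gradients_independent : exists2 A : 'M[R]_n, A \in unitmx &
  forall i, sdiff (peval (tnth pi i)) p (row i A).
Proof.
have /choice[a Ha] : forall i, exists a, sdiff (peval (tnth pi i)) p a.
  by move=> i; exact: sdiff_peval.
exists (\matrix_i a i); last by move=> i; rewrite rowK.
set A := \matrix_i a i; apply/negPn/negP => nu.
have /rowV0Pn[w /sub_kermxP wA w0] : kermx A^T != 0.
  by rewrite kermx_eq0 row_free_unit unitmx_tr.
have wa i : dot w (a i) = 0.
  have := congr1 (fun u : 'rV_n => u 0 i) wA; rewrite !mxE => <-.
  by rewrite dotE; apply: eq_bigr => j _; rewrite !mxE.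
have [F [c [[f fF] invF c0 sF]]] := invariant_with_gradient w.
have [h fh] : exists h, f = comp_mpoly pi h.
  case: Hpi => _ _ _ gen _; apply: gen => g v Gg; rewrite -fF; exact: invF.
have [b [sb wb]] : exists b, sdiff F p b /\ dot w b = 0.
  rewrite fF fh (_ : peval _ = fun x => meval (fun i => peval (tnth pi i) x) h); last first.
    by apply/funext => x; rewrite /peval comp_mpoly_meval.
  apply: (@meval_ind R 'rV[R]_n n (fun f => exists b, sdiff f p b /\ dot w b = 0)).
  - by move=> k; exists 0; split; [exact: sdiff_cst|rewrite dotC dot0l].
  - move=> u v [b [ub wb]] [d [vd wd]]; exists (b + d).
    by split; [exact: sdiffD|rewrite dotDr wb wd addr0].
  - move=> u v [b [ub wb]] [d [vd wd]]; exists (u p *: d + v p *: b).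
    by split; [exact: sdiffM|rewrite dotDr !dotZr wb wd !mulr0 addr0].
  - by move=> i; exists (a i).
move: wb; rewrite (sdiff_unique sb sF) dotZr => /eqP.
by rewrite mulf_eq0 dotvv_eq0 (negPf w0) orbF gt_eqF.
Qed.

Lemma orbit_map_open e : 0 < e -> exists2 d, 0 < d &
  forall z : 'rV[R]_n, enorm (z - \row_i peval (tnth pi i) p) < d ->
    exists2 x, enorm (x - p) < e & forall i, peval (tnth pi i) x = z 0 i.
Proof.
move=> e0; have [A Au sA] := gradients_independent.
have poly i : polyfun (peval (tnth pi i)) by exact: polyfun_peval.
have [d d0 hd] := local_surjection poly Au sA e0; exists d => // z /hd[x xe <-].
by exists x => // i; rewrite mxE.
Qed.

End OrbitMap.

(** * Extreme points on spheres *)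

Lemma deg_homog (R : realType) n (f : mpoly n R) d :
  f \is ishomog1 d mdeg -> (deg f <= d)%N.
Proof.
have [->|f0] := eqVneq f 0; first by rewrite /deg msize0.
by move=> fd; rewrite (dhomog_uniq f0 fd (dhomog_msize fd)).
Qed.

Lemma homog_deg (R : realType) n (f : mpoly n R) d :
  f \is ishomog1 d mdeg -> f \is ishomog1 (deg f) mdeg.
Proof. exact: dhomog_msize. Qed.

(** * Weights of the basic invariants in an invariant polynomial *)

Section GradedRepresentation.
Variables (R : realType) (n : nat) (G : set 'M[R]_n) (pi : n.-tuple (mpoly n R)).
Hypothesis Hpi : basic_invariants G pi.
Variable f : mpoly n R.
Hypothesis Hf : invariant_poly G f.

(* Terms of weighted degree above [deg f] cancel, so they can be dropped. *)
Lemma graded_representation : exists (s : seq (multinom n)) (c : multinom n -> R),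
  f = \sum_(m <- s) c m *: \prod_i tnth pi i ^+ m i /\
  forall m, m \in s -> (\sum_i deg (tnth pi i) * m i <= deg f)%N.
Proof.
have [_ hom _ gen _] := Hpi; have [h fh] := gen f Hf.
pose w (m : multinom n) := (\sum_i deg (tnth pi i) * m i)%N.
exists [seq m <- msupp h | (w m <= deg f)%N], (fun m => mcoeff m h); split; last first.
  by move=> m; rewrite mem_filter => /andP[].
pose T (m : multinom n) : mpoly n R := \prod_i tnth pi i ^+ m i.
have homT m : T m \is ishomog1 (w m) mdeg.
  rewrite /T /w; elim/big_rec2: _ => [|i k g _ gk]; first exact: dhomog1.
  apply: dhomogM => //; apply: dhomogMn.
  by have [d /homog_deg] := hom i.
have := @pihomog_partitionE n R mdeg (deg f).+1 f.
rewrite /deg leqSpred => /(_ isT); rewrite -/(deg f); set D := deg f => fE.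
have {}fh : f = \sum_(m <- msupp h) mcoeff m h *: T m by rewrite fh comp_mpolyE.
have Z (e : nat) : pihomog mdeg e f =
    \sum_(m <- msupp h) if e == w m then mcoeff m h *: T m else 0.
  rewrite fh raddf_sum; apply: eq_bigr => m _ /=; rewrite linearZ /=.
  case: eqP => [->|/eqP we]; first by rewrite (pihomog_dE (homT m)).
  by rewrite (pihomog_ne0 _ (homT m)) ?scaler0 // eq_sym.
rewrite [LHS]fE big_filter (eq_bigr _ (fun (e : 'I_D.+1) _ => Z e)).
rewrite exchange_big /= [RHS]big_mkcond; apply: eq_bigr => m _.
rewrite -[LHS]big_mkcond /= -ltnS; case: ltnP => wd.
  by rewrite (big_pred1 (Ordinal wd)) // => e; rewrite -val_eqE.
rewrite big_pred0 // => e; apply/negbTE; rewrite neq_ltn.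
by rewrite (leq_trans (ltn_ord e)).
Qed.

(** By the weight bound, the chosen invariant has exponent at most 1 in each term, and exponent 0 if
    its degree exceeds [deg f]. *)
Lemma affine_in_top_invariant (i0 : 'I_n) q :
  (deg f < 2 * deg (tnth pi i0))%N ->
  exists B : R, ((deg f < deg (tnth pi i0))%N -> B = 0) /\
    forall x, (forall j, j != i0 -> peval (tnth pi j) x = peval (tnth pi j) q) ->
      peval f x = peval f q + B * (peval (tnth pi i0) x - peval (tnth pi i0) q).
Proof.
move=> f2; have [s [c [fE sw]]] := graded_representation.
have mw m : m \in s -> (deg (tnth pi i0) * m i0 <= deg f)%N.
  by move=> /sw; apply: leq_trans; rewrite (bigD1 i0) //= leq_addr.
have evf x : peval f x = \sum_(m <- s) c m *
    (peval (tnth pi i0) x ^+ m i0 * \prod_(j | j != i0) peval (tnth pi j) x ^+ m j).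
  rewrite fE /peval raddf_sum; apply: eq_bigr => m _; rewrite /= mevalZ rmorph_prod.
  by rewrite (bigD1 i0) //= rmorphXn; under eq_bigr do rewrite rmorphXn.
(* With exponents 0 or 1, the factor [(m i0)%:R] selects the terms that contain the chosen
   invariant. *)
exists (\sum_(m <- s) c m * (m i0)%:R * \prod_(j | j != i0) peval (tnth pi j) q ^+ m j).
split=> [fd|x xq].
  rewrite big_seq big1 // => m /mw h; have -> : m i0 = 0%N by nia.
  by rewrite mulr0 mul0r.
rewrite !evf mulr_suml -big_split big_seq [RHS]big_seq; apply: eq_bigr => m /mw h /=.
rewrite (eq_bigr (fun j => peval (tnth pi j) q ^+ m j)); last by move=> j /xq->.
have : (m i0 < 2)%N by nia.
case: (m i0) => [|[|//]] _; rewrite ?expr0 ?expr1; ring.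
Qed.

End GradedRepresentation.

Section ExtremePoints.
Variables (R : realType) (n : nat).
Implicit Types (G H : set 'M[R]_n) (f : mpoly n R) (p q x : 'rV[R]_n).

Lemma sqnorm_poly : exists N : mpoly n R,
  (deg N <= 2)%N /\ forall x, peval N x = dot x x.
Proof.
exists (\sum_i mpolyX R (mnm_add (mnm1 i) (mnm1 i))); split.
  apply: deg_homog; apply: rpred_sum => i _.
  by rewrite dhomogX /= mdegD !mdeg1.
move=> x; rewrite /peval raddf_sum dotE; apply: eq_bigr => i _.
by rewrite /= mpolyXD mevalM !mevalXU.
Qed.

(** Changing only the invariant [i0] near [q] keeps the norm, since the squared norm has degree 2
    and does not involve it. As the change can have either sign, extremality forces [B = 0]; then
    [f] is constant along the motion and all points reached are extreme. *)
Lemma not_extreme_of_affine H (pi : n.-tuple (mpoly n R)) (i0 : 'I_n) p q f (B : R) :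
  reflection_group H -> basic_invariants H pi -> general H q ->
  (2 < deg (tnth pi i0))%N ->
  (forall x, (forall j, j != i0 -> peval (tnth pi j) x = peval (tnth pi j) q) ->
    peval f x = peval f q + B * (peval (tnth pi i0) x - peval (tnth pi i0) q)) ->
  finite_set (extreme_points (sphere_through p) f) ->
  ~ extreme_points (sphere_through p) f q.
Proof.
move=> HH Hpi Hq top aff /finite_seqP[E EE] [Kq ext].
pose agree x := forall j, j != i0 -> peval (tnth pi j) x = peval (tnth pi j) q.
have agreeK x : agree x -> sphere_through p x.
  have [N [N2 NE]] := sqnorm_poly.
  have invN : invariant_poly H N by move=> g v Hg; rewrite !NE (dot_group HH).
  have [|b [b0 hb]] := @affine_in_top_invariant _ _ _ _ Hpi _ invN i0 q; first by lia.
  move=> /hb; rewrite b0 ?mul0r ?addr0 ?NE; last by lia.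
  by rewrite /sphere_through /= -Kq !enormE => ->.
(* The sign [s] treats maxima and minima together. *)
have core (s : R) : `|s| = 1 ->
    (exists2 e : R, 0 < e & forall x, sphere_through p x -> enorm (x - q) < e ->
      s * peval f x <= s * peval f q) ->
    (forall y, sphere_through p y -> (exists2 e : R, 0 < e &
      forall x, sphere_through p x -> enorm (x - y) < e ->
      s * peval f x <= s * peval f y) -> extreme_points (sphere_through p) f y) -> False.
  move=> s1 [e e0 he] toext.
  have e2 : 0 < e / 2 by rewrite divr_gt0.
  have [d d0 hd] := orbit_map_open HH Hpi Hq e2.
  have /choice[X HX] : forall t : R, exists x, `|t| < d ->
      [/\ enorm (x - q) < e / 2, agree x &
          peval (tnth pi i0) x = peval (tnth pi i0) q + t].
    move=> t; have [td|] := boolP (`|t| < d); last by exists 0.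
    have [|x xq hx] := hd (\row_i (peval (tnth pi i) q) + t *: delta_mx 0 i0).
      rewrite addrC addKr enormZ (_ : enorm _ = 1) ?mulr1 // enormE dotE.
      rewrite (bigD1 i0) //= big1 ?mxE ?eqxx ?mulr1 ?addr0 ?sqrtr1 // => j ji.
      by rewrite mxE (negPf ji) andbF mulr0.
    exists x => _; split=> // [j ji|]; rewrite hx !mxE ?eqxx ?mulr1 //.
    by rewrite (negPf ji) andbF mulr0 addr0.
  have fX t : `|t| < d -> peval f (X t) = peval f q + B * t.
    by move=> /HX[_ /aff -> ->]; rewrite [_ + t]addrC addrK.
  have near t : `|t| < d -> s * (peval f q + B * t) <= s * peval f q.
    move=> td; rewrite -fX //; have [xe ax _] := HX t td; apply: he; first exact: agreeK.
    by apply: lt_trans xe _; rewrite ltr_pdivrMr // mulr_natr mulr2n ltrDl.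
  have d2 : 0 < d / 2 by rewrite divr_gt0.
  have d2d : d / 2 < d by rewrite ltr_pdivrMr // mulr_natr mulr2n ltrDl.
  have B0 : B = 0.
    have := near (d / 2); rewrite gtr0_norm // => /(_ d2d).
    have := near (- (d / 2)); rewrite normrN gtr0_norm // => /(_ d2d).
    rewrite !mulrDr !gerDl mulrN mulrN oppr_le0 mulrA => h1 h2.
    have : s * B * (d / 2) == 0 by rewrite eq_le h1 h2.
    rewrite !mulf_eq0 (gt_eqF d0) invr_eq0 pnatr_eq0 !orbF => /orP[|/eqP//].
    by rewrite -normr_eq0 s1 oner_eq0.
  have XE t : `|t| < d -> X t \in E.
    move=> td; have [xe ax _] := HX t td.
    have : [set` E] (X t); last by [].
    rewrite -EE; apply: toext; first exact: agreeK.
    (* The ball of radius [e / 2] around [X t] lies in the ball of radius [e] around [q], where [q]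
       is extreme. *)
    exists (e / 2) => // x Kx xX; rewrite fX // B0 mul0r addr0; apply: he => //.
    by apply: le_lt_trans (enorm_dist _ (X t) _) _; rewrite [e]splitr ltrD.
  pose t k : R := d / k.+2%:R.
  have td k : `|t k| < d.
    rewrite gtr0_norm ?divr_gt0 // ltr_pdivrMr // ltr_pMr //.
    by rewrite ltr1n.
  have tinj : injective t.
    by move=> k l /(mulfI (lt0r_neq0 d0)) /invr_inj /eqP; rewrite eqr_nat => /eqP[].
  have /uniq_leq_size : uniq [seq X (t k) | k <- iota 0 (size E).+1].
    rewrite map_inj_uniq ?iota_uniq // => k l kl; apply: tinj.
    have [_ _ h1] := HX _ (td k); have [_ _ h2] := HX _ (td l).
    by apply: (@addrI _ (peval (tnth pi i0) q)); rewrite -h1 -h2 kl.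
  move=> /(_ E) h; suff : (size [seq X (t k) | k <- iota 0 (size E).+1] <= size E)%N.
    by rewrite size_map size_iota ltnn.
  by apply: h => _ /mapP[k _ ->]; exact: XE.
case: ext => -[e e0 he].
- apply: (core 1); rewrite ?normr1 //.
    by exists e => // x Kx xe; rewrite !mul1r; exact: he.
  move=> y Ky [e' e'0 he']; split=> //; left; exists e' => // x Kx xe.
  by have := he' x Kx xe; rewrite !mul1r.
- apply: (core (-1)); rewrite ?normrN1 //.
    by exists e => // x Kx xe; rewrite !mulN1r lerN2; exact: he.
  move=> y Ky [e' e'0 he']; split=> //; right; exists e' => // x Kx xe.
  by have := he' x Kx xe; rewrite !mulN1r lerN2.
Qed.

Lemma invariant_subgroup G H f : H `<=` G -> invariant_poly G f -> invariant_poly H f.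
Proof. by move=> HG fG g v /HG; exact: fG. Qed.

(** If [deg f <= d < 2 * m], then [f] is affine in the top invariant of the subgroup. If [f] only
    involves the first invariants of [G], these have degree at most [d / 2 < m], so none of them
    involves that top invariant and the slope is 0. *)
Lemma extreme_not_general G (pi : n.-tuple (mpoly n R)) d p q f :
  (4 <= d)%N -> basic_invariants G pi -> invariant_poly G f ->
  (deg f <= d)%N \/
    (exists2 k : 'I_n, in_first_invariants pi k f & (2 * deg (tnth pi k) <= d)%N) ->
  finite_set (extreme_points (sphere_through p) f) ->
  extreme_points (sphere_through p) f q -> ~ has_general_subgroup G d q.
Proof.
move=> d4 Hpi Hf dichotomy fin ext [H [m [[HH HG] Hq [pi' Hpi' mE] dm]]].
have m0 : (0 < m)%N by lia.
have [i0 top] : exists i0, m = deg (tnth pi' i0).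
  rewrite mE in m0 *; elim/big_ind: _ m0 => // [x y hx hy|i _ _]; last by exists i.
  by case: (leqP x y).
have [B aff] : exists B, forall x,
    (forall j, j != i0 -> peval (tnth pi' j) x = peval (tnth pi' j) q) ->
    peval f x = peval f q + B * (peval (tnth pi' i0) x - peval (tnth pi' i0) q).
  case: dichotomy => [fd|[k [h fh] kd]].
    have [|B [_ hB]] := affine_in_top_invariant Hpi' (invariant_subgroup HG Hf) (i0 := i0) q.
      by rewrite -top; lia.
    by exists B.
  exists 0 => x agree; rewrite mul0r addr0 fh /peval !comp_mpoly_meval.
  apply: meval_eq => i; rewrite !tnth_mktuple -!/(peval _ _).
  case: Hpi => invpi _ _ _ mono.
  have id : (deg (tnth pi (widen_ord (ltn_ord k) i)) < deg (tnth pi' i0))%N.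
    have : (deg (tnth pi (widen_ord (ltn_ord k) i)) <= deg (tnth pi k))%N.
      by apply: mono => /=; rewrite -ltnS.
    by rewrite -top; lia.
  have [|B [B0 hB]] := affine_in_top_invariant Hpi'
      (invariant_subgroup HG (invpi (widen_ord (ltn_ord k) i))) (i0 := i0) q; first by lia.
  by rewrite hB // B0 // mul0r addr0.
apply: (not_extreme_of_affine HH Hpi' Hq _ aff fin ext).
by rewrite -top; lia.
Qed.

End ExtremePoints.

(** * Flats *)

(** A vector [v] avoiding the tail is moved, if it lies in the head [H], along some [u] of [F]
    outside [H]. The line [v + t *: u] meets each other subspace for at most one [t], and [H] only
    for [t = 0]. *)
Lemma avoid_subspaces (R : realType) m n (F : 'M[R]_(m, n)) (L : seq 'M[R]_n) :
  (forall K, K \in L -> ~~ (F <= K)%MS) ->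
  exists2 v : 'rV[R]_n, (v <= F)%MS & forall K, K \in L -> ~~ (v <= K)%MS.
Proof.
elim: L => [|H L IH] hL; first by exists 0; rewrite ?sub0mx.
have [|v vF vL] := IH; first by move=> K KL; apply: hL; rewrite inE KL orbT.
have [vH|vH] := boolP (v <= H)%MS; last first.
  by exists v => // K; rewrite inE => /predU1P[->|/vL].
have /row_subPn[i uH] := hL H (mem_head _ _); set u := row i F in uH.
have /choice[b hb] : forall K, exists b : R, forall t, K \in L ->
    ((v + t *: u)%R <= K)%MS -> t = b.
  move=> K; have [[b bK]|nb] := pselect (exists b : R, ((v + b *: u)%R <= K)%MS); last first.
    by exists 0 => t _ tK; case: nb; exists t.
  exists b => t KL tK; apply/eqP; rewrite -subr_eq0; apply/negPn/negP => tb.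
  have uK : (u <= K)%MS.
    have -> : u = (t - b)^-1 *: ((v + t *: u) - (v + b *: u)).
      by rewrite opprD addrACA subrr add0r -scalerBl scalerA mulVf // scale1r.
    by apply/scalemx_sub/addmx_sub => //; rewrite -scaleN1r; exact: scalemx_sub.
  have : (v <= K)%MS.
    by rewrite -(addrK (b *: u) v); apply: addmx_sub => //; rewrite -scaleNr; exact: scalemx_sub.
  by apply/negP/vL.
have [t tL] : exists t : R, t \notin 0 :: map b L.
  exists (1 + \sum_(x <- 0 :: map b L) `|x|); apply/negP; set s := 0 :: _.
  have s0 : 0 <= \sum_(x <- s) `|x| by apply: sumr_ge0.
  have sx x : x \in s -> x <= \sum_(x <- s) `|x|.
    move=> xs; apply: le_trans (ler_norm x) _.
    by rewrite (big_rem x xs) /= lerDl sumr_ge0.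
  by move=> /sx; lra.
exists (v + t *: u); first by rewrite addmx_sub // scalemx_sub // row_sub.
move: tL; rewrite inE negb_or => /andP[t0 tL] K; rewrite inE => /predU1P[->|KL].
  apply: contra uH => h; have -> : u = t^-1 *: ((v + t *: u) - v).
    by rewrite addrC addKr scalerA mulVf // scale1r.
  by apply/scalemx_sub/addmx_sub => //; rewrite -scaleN1r; exact: scalemx_sub.
apply: contra tL => /(hb _ _ KL) ->; exact: map_f.
Qed.

Section Flats.
Variables (R : realType) (n : nat) (G : set 'M[R]_n).
Implicit Types (S T : seq 'M[R]_n) (s t : 'M[R]_n).

Lemma sub_flat m (A : 'M[R]_(m, n)) S :
  (A <= flat S)%MS = all (fun s => (A <= hyperplane s)%MS) S.
Proof.
elim: S => [|s S IH]; first by rewrite /flat big_nil submx1.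
by rewrite /flat big_cons sub_capmx -/(flat S) IH.
Qed.

Lemma rank_hyperplane s : is_reflection s -> (n <= (\rank (hyperplane s)).+1)%N.
Proof.
case=> a _ ->; rewrite /hyperplane mxrank_ker addrAC subrr add0r -scaleNr.
set M := _ *: _; suff : (\rank M <= 1)%N by lia.
by apply: leq_trans (mxrank_scale _ _) _; apply: leq_trans (mxrankM_maxr _ _) (rank_leq_row _).
Qed.

Lemma rank_flat_cons s S : is_reflection s ->
  (\rank (flat S) <= (\rank (flat (s :: S))).+1)%N.
Proof.
move=> /rank_hyperplane; rewrite {2}/flat big_cons -/(flat S) => h.
have := mxrank_sum_cap (hyperplane s) (flat S).
have := rank_leq_col (hyperplane s + flat S)%MS; lia.
Qed.

Lemma rank_flat0 : \rank (flat (R := R) (n := n) [::]) = n.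
Proof. by rewrite /flat big_nil mxrank1. Qed.

(** Each further hyperplane lowers the dimension by at most one, so every intermediate dimension
    occurs. *)
Lemma flat_of_rank S T i : (forall t, t \in T -> is_reflection t) ->
  (\rank (flat (T ++ S)) <= i <= \rank (flat S))%N ->
  exists2 T', {subset T' <= T} & \rank (flat (T' ++ S)) = i.
Proof.
elim: T => [|t T IH] hT /=.
  by move=> h; exists [::] => //=; apply/eqP; rewrite eqn_leq.
move=> /andP[h1 h2].
have hT' u : u \in T -> is_reflection u by move=> uT; apply: hT; rewrite inE uT orbT.
have [h|h] := leqP (\rank (flat (T ++ S))) i.
  have [|T' sub rT'] := IH hT'; first by rewrite h.
  by exists T' => // u /sub; rewrite inE orbC => ->.
exists (t :: T) => //=; have := rank_flat_cons (T ++ S) (hT t (mem_head _ _)); lia.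
Qed.

Hypotheses (HG : reflection_group G) (Hess : essential G).

Lemma all_reflections : exists L : seq 'M[R]_n, forall s, s \in L <-> reflections G s.
Proof.
have /finite_seqP[F GF] : finite_set G by case: HG.
exists [seq s <- F | `[< is_reflection s >]] => s; rewrite mem_filter GF.
by split=> [/andP[/asboolP ? ?]|[? ?]]; [split|apply/andP; split=> //; apply/asboolP].
Qed.

Lemma sub_hyperplane s (v : 'rV[R]_n) : (v <= hyperplane s)%MS = (v *m s == v).
Proof.
by apply/sub_kermxP/eqP => [/eqP|e]; rewrite mulmxBr mulmx1 ?e ?subrr // subr_eq0 => /eqP.
Qed.

Lemma essential_flat0 L : (forall s, reflections G s -> s \in L) -> flat L = 0.
Proof.
move=> hL; apply/eqP/rowV0P => v; rewrite sub_flat => /allP vL.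
apply: Hess => g Gg; case: HG => _ _ /(_ g Gg)[S hS ->].
elim: S hS => [|s S IH] hS; first by rewrite big_nil mulmx1.
have := vL s (hL s (hS s (mem_head _ _))); rewrite sub_hyperplane => /eqP vs.
rewrite big_cons mulmxA vs; apply: IH => t tS; apply: hS.
by rewrite inE tS orbT.
Qed.

(* If the smallest flat [F] through [q] has dimension above [l], then it has a *)
(* subflat of dimension [l.+1]; a subgroup for which a generic point of the    *)
(* subflat is general also has [q] as a general point.                         *)
Lemma flat_points_of_not_general d l q : delta_bound G d l -> (l <= n)%N ->
  ~ has_general_subgroup G d q -> flat_points G l q.
Proof.
move=> dl ln nq; have [L hL] := all_reflections.
have Lr s : s \in L -> is_reflection s by move=> /hL[].
pose S := [seq s <- L | (q <= hyperplane s)%MS].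
have SL s : s \in S -> s \in L by rewrite mem_filter => /andP[].
have Sq s : s \in S -> (q <= hyperplane s)%MS by rewrite mem_filter => /andP[].
(* Here [flat S] is the smallest flat through [q]. If its dimension is at most [l], dropping
   hyperplanes gives one of dimension exactly [l]. *)
have [h|h] := leqP (\rank (flat S)) l.
  have [||T' sub rT'] := @flat_of_rank [::] S l.
  - by move=> t /SL/Lr.
  - by rewrite cats0 h rank_flat0.
  exists T'; split; first by move=> s /sub/SL/hL.
    by rewrite cats0 in rT'.
  by rewrite sub_flat; apply/allP => s /sub/Sq.
have [|T' sub rT'] := @flat_of_rank S L l.+1 Lr.
  rewrite h andbT (_ : flat _ = 0) ?mxrank0 //; apply: essential_flat0 => s /hL sL.
  by rewrite mem_cat sL.
set F := flat (T' ++ S) in rT'.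
(* A generic [v] lies only on the hyperplanes containing [F], hence on no flat of dimension [l]. *)
have [K|v vF vL] := @avoid_subspaces R n n F
    [seq K <- [seq hyperplane s | s <- L] | ~~ (F <= K)%MS].
  by rewrite mem_filter => /andP[].
have {}vL s : s \in L -> (v <= hyperplane s)%MS -> (F <= hyperplane s)%MS.
  move=> sL vs; apply: contraTT vs => Fs; apply: vL.
  by rewrite mem_filter Fs map_f.
case: nq; have [||H [m [HHG Hv top dm]]] := dl v.
- exists (T' ++ S); split=> // s; rewrite mem_cat => /orP[/sub/hL//|/SL/hL//].
- move=> [U [hU rU vU]]; have : (F <= flat U)%MS.
    rewrite sub_flat; apply/allP => s sU; apply: vL; first exact/hL/hU.
    by move: vU; rewrite sub_flat => /allP; apply.
  by move=> /mxrankS; rewrite rT' rU ltnn.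
exists H, m; split=> // s [Hs rs]; apply: contra (Hv s (conj Hs rs)) => qs.
have sS : s \in S.
  by rewrite mem_filter qs; apply/hL; split=> //; case: HHG => _; apply.
apply: submx_trans vF _; have := submx_refl F; rewrite {2}/F sub_flat => /allP; apply.
by rewrite mem_cat sS orbT.
Qed.

Lemma deltaP d : delta_bound G d (delta G d) /\ (delta G d <= n)%N.
Proof.
rewrite /delta; case: ex_minnP => l /asboolP dl lmin; split=> //; apply: lmin.
apply/asboolP => p [S [_ rS _]].
by have := rank_leq_row (flat S); rewrite rS ltnn.
Qed.

End Flats.

(** * Degrees of the basic invariants of an essential group *)

Section Degrees.
Variables (R : realType) (n : nat) (G : set 'M[R]_n) (pi : n.-tuple (mpoly n R)).
Hypotheses (HG : reflection_group G) (Hess : essential G).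
Hypothesis Hpi : basic_invariants G pi.

Lemma invariant_not_constant i c : tnth pi i <> mpolyC n c.
Proof.
move=> pic; case: Hpi => _ _ indep _ _.
have := indep (mpolyX R (mnm1 i) - mpolyC n c).
rewrite raddfB /= comp_mpolyXU -tnth_nth comp_mpolyC pic subrr => /(_ erefl).
move=> /(congr1 (meval (fun=> c + 1))).
by rewrite mevalB mevalXU mevalC meval0 addrC addKr => /eqP; rewrite oner_eq0.
Qed.

(** The coefficient vector of a linear invariant is fixed by [G], so essentiality applies to it. *)
Lemma linear_invariant_eq0 (f : mpoly n R) :
  invariant_poly G f -> f \is ishomog1 1 mdeg -> f = 0.
Proof.
move=> invf /dhomogP homf; pose a : 'rV[R]_n := \row_j mcoeff (mnm1 j) f.
have fa v : peval f v = dot v a.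
  have {1}-> : f = \sum_j mcoeff (mnm1 j) f *: mpolyX R (mnm1 j).
    apply/mpolyP => m; rewrite raddf_sum /=; under eq_bigr do rewrite mcoeffZ mcoeffX.
    have [mf|mf] := boolP (m \in msupp f).
      have /eqP := homf m mf; rewrite mdeg_eq1 => /existsP[k /eqP->].
      rewrite (bigD1 k) //= eqxx mulr1 big1 ?addr0 // => j jk.
      by rewrite eq_mnm1 (negPf jk) mulr0.
    rewrite memN_msupp_eq0 // big1 // => j _; case: eqP => [jm|]; last by rewrite mulr0.
    by rewrite jm memN_msupp_eq0 // mul0r.
  rewrite /peval raddf_sum dotE; apply: eq_bigr => j _.
  by rewrite /= mevalZ mevalXU mxE mulrC.
have a0 : a = 0.
  apply: Hess => g Gg; apply/eqP; rewrite -subr_eq0 -dotvv_eq0.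
  set w := _ - a; rewrite {2}/w dotBr subr_eq0 -[g in dot w (a *m g)]trmxK -dot_mulmx.
  by rewrite -!fa invf //; exact: (mem_groupT HG).
apply/mpolyP => m; rewrite mcoeff0; apply/eqP; rewrite -[_ == 0]negbK -mcoeff_msupp.
apply/negP => mf; have /eqP := homf m mf; rewrite mdeg_eq1 => /existsP[j /eqP mj].
have := congr1 (fun v : 'rV_n => v 0 j) a0; rewrite !mxE -mj => /eqP.
by apply/negP; rewrite -mcoeff_msupp.
Qed.

Lemma degree_ge2 i : (2 <= deg (tnth pi i))%N.
Proof.
have [invpi hom _ _ _] := Hpi.
have [d /homog_deg homi] := hom i.
case e : (deg (tnth pi i)) => [|[|//]].
  have s1 : (msize (tnth pi i) <= 1)%N by move: e; rewrite /deg; lia.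
  by case: (@invariant_not_constant i (mcoeff mnm0 (tnth pi i))); exact: msize1_polyC.
rewrite e in homi; case: (@invariant_not_constant i 0).
by rewrite mpolyC0; exact: linear_invariant_eq0.
Qed.

End Degrees.

(** * Zeros on rays through extreme points *)

Section Zeros.
Variables (R : realType) (n : nat).
Implicit Types (G : set 'M[R]_n) (f : mpoly n R) (p q : 'rV[R]_n).

Lemma poly_on_ray f q : exists P : {poly R}, forall t, peval f (t *: q) = P.[t].
Proof.
suff [P fP] : exists P : {poly R}, (fun t => peval f (t *: q)) = horner P.
  by exists P => t; rewrite -fP.
apply: (@meval_ind R R n (fun g : R -> R => exists P : {poly R}, g = horner P) _ _ _
  (fun i t => (t *: q) 0 i) _ f).
- by move=> c; exists c%:P; apply/funext => t; rewrite hornerC.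
- by move=> _ _ [P ->] [Q ->]; exists (P + Q); apply/funext => t; rewrite hornerD.
- by move=> _ _ [P ->] [Q ->]; exists (P * Q); apply/funext => t; rewrite hornerM.
- move=> i; exists ((q 0 i) *: 'X); apply/funext => t.
  by rewrite mxE hornerZ hornerX mulrC.
Qed.

Lemma zero_on_ray f q : peval f 0 * peval f q <= 0 ->
  exists t, peval f (t *: q) = 0.
Proof.
move=> h; have [P fP] := poly_on_ray f q.
have P0 : P.[0] = peval f 0 by rewrite -fP scale0r.
have P1 : P.[1] = peval f q by rewrite -fP scale1r.
have ivt (Q : {poly R}) : Q.[0] <= 0 <= Q.[1] -> exists t, Q.[t] = 0.
  by move=> /(poly_ivt ler01)[t _ /rootP Qt]; exists t.
have [h0|h0] : P.[0] <= 0 <= P.[1] \/ (- P).[0] <= 0 <= (- P).[1].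
- rewrite !hornerN oppr_le0 oppr_ge0 P0 P1.
  case: (ltgtP (peval f 0) 0) h => [h0|h0|->] h.
  + by left; rewrite -(nmulr_rle0 _ h0) h.
  + by right; rewrite -(pmulr_rle0 _ h0) h.
  + by have [hq|/ltW hq] := leP 0 (peval f q); [left|right]; rewrite ?lexx ?hq.
- by have [t Pt] := ivt _ h0; exists t; rewrite fP.
- have [t /eqP] := ivt _ h0; rewrite hornerN oppr_eq0 => /eqP Pt.
  by exists t; rewrite fP.
Qed.

Lemma attains_extremes_on_sphere f p : exists q1 q2,
  [/\ sphere_through p q1, sphere_through p q2,
      forall x, sphere_through p x -> peval f q1 <= peval f x &
      forall x, sphere_through p x -> peval f x <= peval f q2].
Proof.
(* The square turns the equation of the sphere into the inequality [h x <= 0]. *)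
pose h (x : 'rV[R]_n) := (dot (x - 0) (x - 0) + - enorm p ^+ 2) ^+ 2.
have polyh : polyfun h by exact/polyfunX/polyfunD/polyfun_cst/polyfun_sqnorm.
have hE x : h x <= 0 <-> sphere_through p x.
  rewrite /h subr0 -sqr_enorm; split=> [|/= ->]; last by rewrite subrr expr0n.
  rewrite le_eqVlt ltNge sqr_ge0 orbF sqrf_eq0 subr_eq0.
  by rewrite eqrXn2 ?enorm_ge0 // => /eqP.
have hM x : h x <= 0 -> enorm x <= enorm p by move=> /hE ->.
have hp : h p <= 0 by apply/hE.
have [q1 /hE K1 min1] := polyfun_attains_min (polyfun_peval f) polyh hM hp.
have [q2 /hE K2 min2] := polyfun_attains_min (polyfun_peval (- f)) polyh hM hp.
exists q1, q2; split=> // x /hE hx; first exact: min1.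
by have := min2 x hx; rewrite /peval !mevalN lerN2.
Qed.

Lemma zero_on_flat G (pi : n.-tuple (mpoly n R)) d f :
  reflection_group G -> essential G -> basic_invariants G pi ->
  (4 <= d)%N -> invariant_poly G f -> G_finite f ->
  (deg f <= d)%N \/
    (exists2 k : 'I_n, in_first_invariants pi k f & (2 * deg (tnth pi k) <= d)%N) ->
  real_variety f !=set0 <-> real_variety f `&` flat_points G (delta G d) !=set0.
Proof.
move=> HG Hess Hpi d4 Hf fin dich; split=> [X0|[x []]]; last by exists x.
case: fin => [X1|[p fp fin]]; first by case: X0 => x; rewrite X1.
have [q1 [q2 [K1 K2 min1 max2]]] := attains_extremes_on_sphere f p.
have [dl ln] := deltaP G d.
have Hflat q : extreme_points (sphere_through p) f q -> flat_points G (delta G d) q.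
  move=> ext; apply: (flat_points_of_not_general HG Hess dl ln).
  exact: (extreme_not_general d4 Hpi Hf dich fin ext).
have F1 : flat_points G (delta G d) q1.
  by apply: Hflat; split=> //; right; exists 1 => // x Kx _; exact: min1.
have F2 : flat_points G (delta G d) q2.
  by apply: Hflat; split=> //; left; exists 1 => // x Kx _; exact: max2.
have ray q : flat_points G (delta G d) q -> peval f 0 * peval f q <= 0 ->
    real_variety f `&` flat_points G (delta G d) !=set0.
  move=> [S [hS rS qS]] /zero_on_ray[t ft]; exists (t *: q); split=> //.
  by exists S; split=> //; exact: scalemx_sub.
have f1 : peval f q1 <= 0 by rewrite -[X in _ <= X]fp; exact: min1.
have f2 : 0 <= peval f q2 by rewrite -[X in X <= _]fp; exact: max2.
(* The sign of [f] at the origin decides whether the ray to the minimum or to the maximum has a sign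
   change. *)
have [f0|f0] := leP 0 (peval f 0).
  by apply: (ray q1) => //; rewrite mulr_ge0_le0.
by apply: (ray q2) => //; rewrite mulr_le0_ge0 // ltW.
Qed.

End Zeros.

Theorem theorem16 (R : realType) (n : nat) (G : set 'M[R]_n)
    (hG : reflection_group G) (hess : essential G)
    (pi : n.-tuple (mpoly.mpoly n R)) (hpi : basic_invariants G pi)
    (f : mpoly.mpoly n R) (hf : invariant_poly G f) (hfin : G_finite f) :
  (forall k : 'I_n, in_first_invariants pi k f ->
     (real_variety f !=set0 <->
      real_variety f `&` flat_points G (sigma G pi k) !=set0))
  /\
  (real_variety f !=set0 <->
   real_variety f `&` flat_points G (delta G (maxn 4 (deg f))) !=set0).
Proof.
split=> [k fk|].
  apply: (zero_on_flat hG hess hpi) => //; last by right; exists k.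
  by have := degree_ge2 hG hess hpi k; lia.
apply: (zero_on_flat hG hess hpi) => //; first exact: leq_maxl.
by left; exact: leq_maxr.
Qed.
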